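(* Let $\{B(t)\}_{t\ge0}$ be the standard linear Brownian motion on a probability space $(\Omega,\mathcal F,\mathbb P)$, let $0\le T_1<T_2$ and $\eta>0$ be reals and $\boldsymbol{\mathcal T}=(T_1,T_2)$. Let $\widehat{\mathcal A}(\boldsymbol{\mathcal T};\eta)$ denote the area (whenever it exists) of the $\eta$-tubular neighbourhood $\widehat{\mathfrak T}(\boldsymbol{\mathcal T};\eta)\subset\mathbb R^2$ of the graph of Brownian motion between times $T_1$ and $T_2$. Then $\widehat{\mathcal A}(\boldsymbol{\mathcal T};\eta)$ is a well-defined random variable over the probability space $(\Omega,\mathcal F,\mathbb P)$. Furthermore, its expectation admits the exact expression $$\mathbb E\left[\widehat{\mathcal A}(\boldsymbol{\mathcal T};\eta)\right]=\frac{4}{\sqrt\pi}\,(T_2-T_1)\,\sqrt\eta+2\,(T_2-T_1)\,\eta-\frac{8(\sqrt2-1)}{3\sqrt\pi}\,\eta^{3/2}$$ provided that $\eta<(T_2-T_1)/2$. Also, almost surely as $\eta\to0^+$, the asymptotic estimate $$\widehat{\mathcal A}(\boldsymbol{\mathcal T};\eta)=\left(\frac{4}{\sqrt\pi}+o(1)\right)(T_2-T_1)\,\sqrt\eta$$ is satisfied.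
   Context: The graph of Brownian motion between times $T_1$ and $T_2$ is $\mathcal G(\boldsymbol{\mathcal T})=\{(t,B(t)):T_1\le t\le T_2\}$. For $\boldsymbol s=(s_1,s_2)\in\mathbb R^2$ set $\mathrm{dist}(\boldsymbol s,\mathcal G(\boldsymbol{\mathcal T}))=\inf_{T_1\le t\le T_2}\max\{|t-s_1|,|B(t)-s_2|\}$ (sup-norm distance). The $\eta$-tubular neighbourhood is $$\widehat{\mathfrak T}(\boldsymbol{\mathcal T};\eta)=\left\{\boldsymbol s\in\mathbb R^2:\ \mathrm{dist}(\boldsymbol s,\mathcal G(\boldsymbol{\mathcal T}))\le\eta\right\}.$$ $\mathbb E$ denotes expectation with respect to $\mathbb P$.
   Formalization: The printed expectation is false for the tube as defined: the end caps outside [T1,T2] add area. It is proved for the part of the tube over T1≤s1≤T2; for the whole tube the exact value proved is the printed one plus 8√2/(3√π)·η^{3/2}+4η². *)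

(* Defs.v *)
(* MathComp-Analysis, over an arbitrary [R : realType]. *)
From mathcomp Require Export all_boot all_order all_algebra.
From mathcomp Require Export all_classical all_reals all_analysis.

Set Implicit Arguments.
Unset Strict Implicit.
Unset Printing Implicit Defensive.

Export Order.TTheory GRing.Theory Num.Theory.
Export numFieldNormedType.Exports.

Global Open Scope classical_set_scope.
Global Open Scope ring_scope.

(* The product rule over proper subfamilies is the case where some of the
   events are [A i = setT]. *)
Definition mutually_independent (d : measure_display)
    (Omega : measurableType d) (R : realType) (P : probability Omega R)
    (n : nat) (X : 'I_n -> Omega -> R) : Prop :=
  forall A : 'I_n -> set R, (forall i, measurable (A i)) ->
    P (\bigcap_(i in [set: 'I_n]) (X i @^-1` A i)) =
    (\prod_(i < n) P (X i @^-1` A i))%E.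

(* Only the times [0 <= t] matter: no condition bears on [B t] for [t < 0].
   The second parameter of [normal_prob] is the standard deviation, so the
   increment over [s, t] has variance [t - s]. *)
Record standard_brownian_motion (d : measure_display)
    (Omega : measurableType d) (R : realType) (P : probability Omega R)
    (B : R -> {RV P >-> R}) : Prop := {
  brownian_start : {ae P, forall w, B 0 w = 0} ;
  brownian_independent_increments :
    forall (n : nat) (t : nat -> R),
      0 <= t 0%N -> (forall i, (i < n)%N -> t i <= t i.+1) ->
      mutually_independent P
        (fun (i : 'I_n) (w : Omega) => B (t i.+1) w - B (t i) w) ;
  brownian_gaussian_increments :
    forall s t : R, 0 <= s -> s < t ->
      forall A : set R, measurable A ->
        P ((fun w => B t w - B s w) @^-1` A) =
        normal_prob 0 (Num.sqrt (t - s)) A ;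
  brownian_continuous :
    {ae P, forall w, {within `[0, +oo[, continuous (fun t => B t w)}} }.

Section tubular_neighbourhood.
Context (R : realType).

(* Sup-norm distance from [s] to the graph of [f] over [T1, T2]. *)
Definition graph_dist (f : R -> R) (T1 T2 : R) (s : R * R) : R :=
  inf [set Num.max `|t - s.1| `|f t - s.2| | t in `[T1, T2]].

Definition tube (f : R -> R) (T1 T2 eta : R) : set (R * R) :=
  [set s | graph_dist f T1 T2 s <= eta].

(* The part of the tube between times [T1] and [T2].  The full tube also has
   caps over [T1 - eta, T1[ and ]T2, T2 + eta]. *)
Definition tube_between (f : R -> R) (T1 T2 eta : R) : set (R * R) :=
  tube f T1 T2 eta `&` [set s | T1 <= s.1 <= T2].

Definition lebesgue_measure2 : set (R * R) -> \bar R :=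
  (@lebesgue_measure R \x @lebesgue_measure R)%E.

(* Meaningful for measurable sets of finite measure. *)
Definition area (S : set (R * R)) : R := fine (lebesgue_measure2 S).

End tubular_neighbourhood.

(* The area of [S eta w] is a well-defined random variable for every
   [eta > 0].  Since paths are only almost surely continuous, the area exists
   almost surely, on an event that does not depend on [eta], and agrees there
   with a random variable defined on all of [Omega]. *)
Definition area_well_defined (d : measure_display)
    (Omega : measurableType d) (R : realType) (P : probability Omega R)
    (S : R -> Omega -> set (R * R)) : Prop :=
  exists A : R -> {RV P >-> R},
    {ae P, forall w, forall eta : R, 0 < eta ->
      measurable (S eta w) /\ lebesgue_measure2 (S eta w) = (A eta w)%:E}.

(* Main.v *)
Require Import Defs.
From mathcomp Require Import perm measurable_realfun ring lra.

(** Cut the tube of radius eta by the vertical line at time u. If the path is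
    continuous, the slice is a segment, and its length is 2 eta plus the
    oscillation of the path over the window of times of [[T1, T2]] at distance at
    most eta from u ([lebesgue_measure_tube_slice]). The area is the integral of
    these lengths over u, so everything reduces to the law of the oscillation of
    Brownian motion over an interval.

    Expectation. Along a grid of times the path is a random walk with independent
    and identically distributed symmetric steps, and Spitzer's identity
    ([spitzer]) gives the expected maximum of such a walk as the sum over k of the
    expected positive part of the k-th partial sum, divided by k. For normal steps
    the summands are explicit; letting dyadic grids grow finer, monotone convergence
    yields 4 sqrt(L / (2 pi)) for the expected oscillation over an interval of
    length L ([expectation_osc]). By Tonelli's theorem the expected area is the
    integral over u of the expected length of a slice
    ([expectation_swept_area]), where L is 2 eta except near T1 and T2, where the
    window is cut off; this produces the terms in eta^(3/2).

    Measurability. Since the path is continuous, the tube is determined by the path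
    at rational times, which exhibits it as the section of a set that is
    measurable jointly in the outcome and the point of the plane
    ([measurable_tube_event]).

    Almost sure asymptotics. Slices at distance at least 2 eta involve disjoint time
    intervals, so they are uncorrelated ([slice_correlation]), and the second moment
    of a slice is at most of order eta. Hence the variance of the area is of order
    eta^2 ([variance_area_rv]), whereas the mean is of order sqrt eta. The ratios of
    area to sqrt eta therefore converge almost surely along eta = 1/n^2, and since
    the area is monotone in eta they converge without restriction
    ([ae_cvg_of_variance]). *)

Set Implicit Arguments.
Unset Strict Implicit.
Unset Printing Implicit Defensive.

(** * Families of independent, identically distributed variables *)

Section tuple_uniqueness.
Context (R : realType) (n : nat).
Local Open Scope ereal_scope.

Definition tuple_box (A : 'I_n -> set R) : set (n.-tuple R) :=
  [set t | forall i, A i (tnth t i)].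

Lemma measurable_tuple_boxes :
  @measurable _ (n.-tuple R) =
  <<s [set B | exists2 A, (forall i, measurable (A i)) & B = tuple_box A] >>.
Proof.
rewrite eqEsubset; split.
  rewrite [X in X `<=` _]/measurable /= /g_sigma_preimage.
  apply: smallest_sub; first exact: smallest_sigma_algebra.
  rewrite -bigcup_seq; apply: bigcup_sub => i _ _ [Y mY <-].
  rewrite setTI; apply: sub_sigma_algebra.
  exists (fun j => if j == i then Y else setT).
    by move=> j; case: ifP.
  apply/seteqP; split => t /=.
    by move=> Yt j; case: eqP => [->|].
  by move=> /(_ i); rewrite eqxx.
apply: smallest_sub; first exact: sigma_algebra_measurable.
move=> _ [A mA ->].
have -> : tuple_box A = \bigcap_(i in [set: 'I_n]) ((tnth (T:=R))^~ i @^-1` A i).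
  by apply/seteqP; split => t /= h i; [move=> _; exact: h | exact: h].
apply: fin_bigcap_measurable => // i _.
by rewrite -[X in measurable X]setTI; exact: measurable_tnth.
Qed.

(** Boxes are stable under intersection and generate the product sigma-algebra,
    so the pi-lambda theorem applies. *)
Lemma tuple_measure_unique (m1 m2 : {measure set (n.-tuple R) -> \bar R}) :
  m1 setT < +oo ->
  (forall A, (forall i, measurable (A i)) ->
     m1 (tuple_box A) = m2 (tuple_box A)) ->
  forall E, measurable E -> m1 E = m2 E.
Proof.
move=> m1T m12.
pose g (_ : nat) := [set: n.-tuple R].
have gT : tuple_box (fun _ => setT) = setT by apply/seteqP; split.
apply: (measure_unique _ g measurable_tuple_boxes) => //.
- move=> _ _ [A mA ->] [B mB ->].
  exists (fun i => A i `&` B i); first by move=> i; exact: measurableI.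
  apply/seteqP; split => [t [h1 h2] i|t h]; first by split; [exact: h1|exact: h2].
  by split=> i; case: (h i).
- by move=> k; exists (fun _ => setT) => //; rewrite gT.
- by rewrite bigcup_const.
- by move=> _ [A mA ->]; exact: m12.
Qed.

End tuple_uniqueness.

Section iid.
Context d (Omega : measurableType d) (R : realType) (P : probability Omega R).
Implicit Type nu : set R -> \bar R.
Local Open Scope ereal_scope.

Definition tuple_of_family n (X : 'I_n -> Omega -> R) (w : Omega) : n.-tuple R :=
  [tuple X i w | i < n].

Lemma measurable_tuple_of_family n (X : 'I_n -> Omega -> R) :
  (forall i, measurable_fun setT (X i)) ->
  measurable_fun setT (tuple_of_family X).
Proof.
move=> mX; apply/measurable_fun_tnthP => i.
have -> : (@tnth _ _)^~ i \o tuple_of_family X = X i.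
  by apply/funext => w /=; rewrite tnth_mktuple.
exact: mX.
Qed.

Lemma preimage_tuple_box n (X : 'I_n -> Omega -> R) A :
  tuple_of_family X @^-1` tuple_box A =
  \bigcap_(i in [set: 'I_n]) (X i @^-1` A i).
Proof.
apply/seteqP; split=> w /= h i.
  by move=> _; have := h i; rewrite tnth_mktuple.
by rewrite tnth_mktuple; exact: h.
Qed.

(** Joint law given on boxes only, with [nu] the common law of the variables; on
    increments this is the form in which independence is available. *)
Definition iid nu n (X : 'I_n -> Omega -> R) :=
  (forall i, measurable_fun setT (X i)) /\
  forall A : 'I_n -> set R, (forall i, measurable (A i)) ->
    P (\bigcap_(i in [set: 'I_n]) (X i @^-1` A i)) = \prod_(i < n) nu (A i).

(** The joint law depends on [nu] only, so an expectation may be computed with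
    another family that has the same common law. It is applied to families
    obtained by permuting the variables or changing the sign of one of them. *)
Lemma iid_ge0_integral nu n (X Y : 'I_n -> Omega -> R)
    (F : ('I_n -> R) -> \bar R) :
  iid nu X -> iid nu Y ->
  measurable_fun [set: n.-tuple R] (fun t => F (tnth t)) ->
  (forall x, 0 <= F x) ->
  \int[P]_w F (X ^~ w) = \int[P]_w F (Y ^~ w).
Proof.
move=> [mX hX] [mY hY] mF F0.
have mtX := measurable_tuple_of_family mX.
have mtY := measurable_tuple_of_family mY.
have tE (Z : 'I_n -> Omega -> R) w : tnth (tuple_of_family Z w) = Z ^~ w.
  by apply/funext => i; rewrite tnth_mktuple.
pose f (t : n.-tuple R) := F (tnth t).
transitivity (\int[pushforward P (tuple_of_family X)]_t f t).
  rewrite (@ge0_integral_pushforward _ _ _ _ _ _ mtX P setT f)//; last first.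
    by move=> t _; exact: F0.
  by rewrite preimage_setT; apply: eq_integral => w _; rewrite /f /= tE.
transitivity (\int[pushforward P (tuple_of_family Y)]_t f t); last first.
  rewrite (@ge0_integral_pushforward _ _ _ _ _ _ mtY P setT f)//; last first.
    by move=> t _; exact: F0.
  by rewrite preimage_setT; apply: eq_integral => w _; rewrite /f /= tE.
pose X' : {mfun Omega >-> n.-tuple R} := mfun_Sub (mem_set mtX).
pose Y' : {mfun Omega >-> n.-tuple R} := mfun_Sub (mem_set mtY).
apply: (@eq_measure_integral _ _ _ _ (pushforward P Y') (pushforward P X')).
move=> E mE _.
apply: tuple_measure_unique => //.
  by change (P setT < +oo); rewrite probability_setT ltry.
move=> A mA; rewrite /pushforward.
change (P (tuple_of_family X @^-1` tuple_box A) =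
  P (tuple_of_family Y @^-1` tuple_box A)).
by rewrite !preimage_tuple_box hX// hY.
Qed.

Lemma iid_reindex nu n (X : 'I_n -> Omega -> R) (s : 'I_n -> 'I_n) :
  injective s -> iid nu X -> iid nu (fun i => X (s i)).
Proof.
move=> sI [mX hX]; split=> [i|A mA]; first exact: mX.
have sB := injF_bij sI.
have [r sK rK] := sB.
have := hX (fun i => A (r i)) (fun i => mA (r i)).
rewrite (reindex s)/=; last exact: onW_bij.
under [in X in _ = X -> _]eq_bigr do rewrite sK.
move=> <-; congr (P _); apply/seteqP; split=> w /= h i _.
  by have := h (r i) I; rewrite rK.
by have := h (s i) I; rewrite /= sK.
Qed.

Lemma iid_sign nu n (X : 'I_n -> Omega -> R) (e : 'I_n -> bool) :
  (forall A : set R, measurable A -> nu (-%R @^-1` A) = nu A) ->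
  iid nu X -> iid nu (fun i w => ((-1) ^+ e i * X i w)%R).
Proof.
move=> nuN [mX hX]; split=> [i|A mA]; first by apply: measurable_funM.
have mN (B : set R) : measurable B -> measurable (-%R @^-1` B).
  by move=> mB; rewrite -[X in measurable X]setTI; exact: oppr_measurable.
have := hX (fun i => if e i then -%R @^-1` A i else A i).
have -> : \prod_(i < n) nu (if e i then -%R @^-1` A i else A i) =
    \prod_(i < n) nu (A i).
  by apply: eq_bigr => i _; case: ifP => // _; rewrite nuN.
move=> <-; last by move=> i; case: ifP => // _; exact: mN.
congr (P _); apply/seteqP; split=> w /= h i _; have := h i I;
  by case: (e i) => /=; rewrite ?expr1 ?expr0 ?mul1r ?mulN1r.
Qed.

Lemma iid_drop nu n (X : 'I_n.+1 -> Omega -> R) : nu setT = 1 ->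
  iid nu X -> iid nu (fun i : 'I_n => X (lift ord0 i)).
Proof.
move=> nu1 [mX hX]; split=> [i|A mA]; first exact: mX.
have := hX (fun i => if unlift ord0 i is Some j then A j else setT).
rewrite big_ord_recl unlift_none nu1 mul1e.
under [X in (_ -> _ = X) -> _]eq_bigr do rewrite liftK.
move=> <-; last by move=> i; case: unliftP.
congr (P _); apply/seteqP; split=> w /= h i _.
  by case: unliftP => // j ->; exact: h.
by have := h (lift ord0 i) I; rewrite /= liftK.
Qed.

End iid.

(** * The maximum of a random walk *)

Section walk_max.
Context (R : realType).
Implicit Types (s p : seq R) (x y c : R).

(** The largest partial sum of the walk with steps [s], the empty sum included,
    written as a recursion on the first step: the maximum of the walk is the
    positive part of the first step plus the maximum of the remaining walk. *)
Definition walk_max s : R := foldr (fun x m => Num.max 0 (x + m)) 0 s.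

Lemma walk_max_ge0 s : 0 <= walk_max s.
Proof. by case: s => //= x s; rewrite le_max lexx. Qed.

Lemma walk_max_rcons s y :
  walk_max (rcons s y) = Num.max (walk_max s) (\sum_(x <- s) x + y).
Proof.
elim: s => [|x s IH] /=; first by rewrite big_nil addr0 add0r.
by rewrite IH big_cons addr_maxr maxA addrA.
Qed.

Lemma sum_le_walk_max s : \sum_(x <- s) x <= walk_max s.
Proof.
elim: s => [|x s IH] /=; first by rewrite big_nil.
by rewrite big_cons le_max lerD2l IH orbT.
Qed.

Lemma walk_max_pos x s : 0 < x + \sum_(y <- s) y ->
  walk_max (x :: s) = x + walk_max s.
Proof.
move=> h /=; apply/max_idPr/ltW/(lt_le_trans h).
by rewrite lerD2l sum_le_walk_max.
Qed.

Lemma walk_max_npos s y : \sum_(x <- s) x + y <= 0 ->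
  walk_max (rcons s y) = walk_max s.
Proof.
move=> h; rewrite walk_max_rcons; apply/max_idPl/(le_trans h).
exact: walk_max_ge0.
Qed.

Lemma walk_max_le s c : 0 <= c ->
  (forall k, (k <= size s)%N -> \sum_(x <- take k s) x <= c) -> walk_max s <= c.
Proof.
move=> c0; elim/last_ind: s => [//|s y IH] h.
rewrite walk_max_rcons ge_max IH/=; last first.
  move=> k ks; have := h k; rewrite size_rcons -cats1 takel_cat//; apply.
  exact: leqW.
by have := h _ (leqnn _); rewrite take_size -cats1 big_cat big_seq1.
Qed.

Lemma walk_max_ge s k : \sum_(x <- take k s) x <= walk_max s.
Proof.
elim: s k => [|x s IH] [|k] //=; rewrite ?big_nil ?big_cons ?le_max ?lexx//.
by rewrite lerD2l IH orbT.
Qed.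

Definition ord_walk_max n (x : 'I_n -> R) : R :=
  walk_max [seq x i | i <- enum 'I_n].

Lemma ord_walk_maxSl n (x : 'I_n.+1 -> R) :
  ord_walk_max x =
  Num.max 0 (x ord0 + ord_walk_max (fun i => x (lift ord0 i))).
Proof. by rewrite /ord_walk_max enum_ordSl /= -map_comp. Qed.

Lemma measurable_ord_walk_max d (T : measurableType d) n (X : 'I_n -> T -> R) :
  (forall i, measurable_fun setT (X i)) ->
  measurable_fun setT (fun w => ord_walk_max (X ^~ w)).
Proof.
move=> mX; rewrite /ord_walk_max; elim: (enum 'I_n) => [|i s IH] /=.
  exact: measurable_cst.
by apply: measurable_maxr => //; exact: measurable_funD.
Qed.

(** If the walk ends above 0, its maximum is attained after the first step,
    which can be taken out; otherwise it is attained before the last step,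
    which can be dropped. *)
Lemma ord_walk_max_split n (x : 'I_n.+1 -> R) :
  ord_walk_max x =
  if 0 < \sum_i x i then x ord0 + ord_walk_max (fun i => x (lift ord0 i))
  else ord_walk_max (fun i => x (widen_ord (leqnSn n) i)).
Proof.
case: ifPn => [h|].
  rewrite /ord_walk_max enum_ordSl /= -[RHS]walk_max_pos /=.
    by rewrite -map_comp.
  move: h; rewrite big_ord_recl big_map.
  by rewrite big_enum.
rewrite -leNgt => h; rewrite /ord_walk_max enum_ordSr map_rcons walk_max_npos//.
  by rewrite -map_comp.
by move: h; rewrite big_ord_recr /= !big_map -big_enum.
Qed.

End walk_max.

Section spitzer.
Context d (Omega : measurableType d) (R : realType) (P : probability Omega R).
Context (nu : set R -> \bar R).
Local Open Scope ereal_scope.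

Local Lemma measurable_ord_sum d' (T : measurableType d') n
    (X : 'I_n -> T -> R) : (forall i, measurable_fun setT (X i)) ->
  measurable_fun setT (fun w => \sum_i X i w)%R.
Proof. by move=> mX; apply: measurable_sum. Qed.

Local Lemma measurable_pos_sum d' (T : measurableType d') n
    (X : 'I_n -> T -> R) (f : T -> R) : (forall i, measurable_fun setT (X i)) ->
  measurable_fun setT f ->
  measurable_fun setT
    (fun w => ((if (0 < \sum_i X i w)%R then f w else 0%R)%:E)).
Proof.
move=> mX mf; apply/measurable_EFinP.
apply: measurable_fun_ifT => //.
exact: measurable_fun_ltr (measurable_cst _) (measurable_ord_sum mX).
Qed.

Local Lemma cancel_scaled_sum (N : R) (a b c m s : \bar R) :
  0 <= a -> 0 <= b -> 0 <= c -> 0 <= m -> b \is a fin_num ->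
  a + b = c + m -> N%:E * c = s + N%:E * b -> N%:E * a = s + N%:E * m.
Proof.
move=> a0 b0 c0 m0 bfin /(congr1 (fun z => N%:E * z)).
rewrite !ge0_muleDr// => h1 h2; move: h1; rewrite h2 addeAC => h.
have f : N%:E * b \is a fin_num by rewrite fin_numM.
by rewrite -[LHS](addeK _ f) h addeK.
Qed.

(** On the event that the walk ends above 0, a cyclic permutation of the steps
    replaces the last steps of [ord_walk_max_split] by the first ones, and by
    symmetry the first step contributes the fraction 1/(n+1) of the positive part
    of the sum. The positive and negative parts of the first step are kept on
    different sides, so that every integrand is nonnegative. *)
Lemma spitzer_step n (X : 'I_n.+1 -> Omega -> R) :
  iid P nu X -> (\int[P]_w `|X ord0 w|%:E < +oo) ->
  n.+1%:R%:E * \int[P]_w (ord_walk_max (X ^~ w))%:E =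
  \int[P]_w (Num.max 0 (\sum_i X i w))%:E +
  n.+1%:R%:E * \int[P]_w (ord_walk_max (fun i => X (widen_ord (leqnSn n) i) w))%:E.
Proof.
move=> iX X0fin; have [mX hX] := iX.
pose pos (f : Omega -> R) := fun w => ((if (0 < \sum_i X i w)%R then f w else 0%R)%:E).
have mpos (f : Omega -> R) : measurable_fun setT f -> measurable_fun setT (pos f).
  exact: measurable_pos_sum.
pose xp i w : R := Num.max 0%R (X i w).
pose xm i w : R := Num.max 0%R (- X i w)%R.
have mxp i : measurable_fun setT (xp i) by apply: measurable_maxr.
have mxm i : measurable_fun setT (xm i).
  by apply: measurable_maxr => //; apply: measurableT_comp.
have xp0 i w : (0 <= xp i w)%R by rewrite le_max lexx.
have xm0 i w : (0 <= xm i w)%R by rewrite le_max lexx.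
have pos0 (f : Omega -> R) w : (0 <= f w)%R -> 0 <= pos f w.
  by rewrite /pos => ?; case: ifP; rewrite lee_fin.
pose M w := ord_walk_max (X ^~ w).
pose Mt w := ord_walk_max (fun i => X (lift ord0 i) w).
pose Mi w := ord_walk_max (fun i => X (widen_ord (leqnSn n) i) w).
have mM : measurable_fun setT M by exact: measurable_ord_walk_max.
have mMt : measurable_fun setT Mt.
  exact: (measurable_ord_walk_max (X := fun i => X (lift ord0 i))).
have mMi : measurable_fun setT Mi.
  exact: (measurable_ord_walk_max (X := fun i => X (widen_ord (leqnSn n) i))).
have M0 w : (0 <= M w)%R by exact: walk_max_ge0.
have Mt0 w : (0 <= Mt w)%R by exact: walk_max_ge0.
have Mi0 w : (0 <= Mi w)%R by exact: walk_max_ge0.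
pose npos w := ((if (0 < \sum_i X i w)%R then 0%R else Mi w)%:E).
have mnpos : measurable_fun setT npos.
  apply/measurable_EFinP; apply: measurable_fun_ifT => //.
  exact: measurable_fun_ltr (measurable_cst _) (measurable_ord_sum mX).
have npos0 w : 0 <= npos w by rewrite /npos; case: ifP; rewrite lee_fin.
have mE (f : Omega -> R) : measurable_fun setT f ->
    measurable_fun setT (fun w => (f w)%:E) by move=> ?; exact/measurable_EFinP.
(* pathwise identity, with the sign of the first step moved across *)
have E1 : \int[P]_w (M w)%:E + \int[P]_w pos (xm ord0) w =
    \int[P]_w pos (xp ord0) w + \int[P]_w pos Mt w + \int[P]_w npos w.
  rewrite -!ge0_integralD//; last 8 first.
  all: try (by move=> w _; rewrite ?adde_ge0 ?pos0 ?lee_fin).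
  all: try exact: mpos.
  all: try exact: mE.
  - apply: eq_integral => w _; rewrite /M ord_walk_max_split /pos /npos.
    case: ifP => _; rewrite -!EFinD; congr EFin; rewrite ?add0r ?addr0//.
    rewrite addrAC; congr (_ + _)%R; rewrite /xm /xp.
    by rewrite addr_maxr addr0 subrr maxC.
  - by apply: emeasurable_funD; exact: mpos.
(* cyclic permutation of the steps *)
have E2 : \int[P]_w pos Mt w + \int[P]_w npos w = \int[P]_w (Mi w)%:E.
  have -> : \int[P]_w pos Mt w = \int[P]_w pos Mi w.
    pose F (x : 'I_n.+1 -> R) := ((if (0 < \sum_i x i)%R then
      ord_walk_max (fun i => x (widen_ord (leqnSn n) i)) else 0%R)%:E).
    have iY := iid_reindex (@ordS_inj n.+1) iX.
    have := @iid_ge0_integral _ _ _ _ _ _ _ _ F iX iY.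
    have -> : \int[P]_w F (X^~ w) = \int[P]_w pos Mi w by [].
    move=> ->; last 2 first.
    + apply: (@measurable_pos_sum _ _ _ (fun i t => tnth t i)).
        by move=> i; exact: measurable_tnth.
      apply: (measurable_ord_walk_max
        (X := fun i t => tnth t (widen_ord (leqnSn n) i))).
      by move=> i; exact: measurable_tnth.
    + by move=> x; rewrite /F; case: ifP => _; rewrite lee_fin// walk_max_ge0.
    apply: eq_integral => w _; rewrite /F /pos.
    rewrite [in LHS](reindex_inj (@ordS_inj n.+1))/=.
    case: ifP => // _; congr EFin; rewrite /Mt; congr ord_walk_max.
    apply/funext => i; congr (X _ w); apply/val_inj => /=.
    by rewrite modn_small// ltnS.
  rewrite -ge0_integralD//.
  + apply: eq_integral => w _; rewrite /pos /npos.
    by case: ifP => _; rewrite ?adde0 ?add0e.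
  + by move=> w _; rewrite pos0.
  + exact: mpos.
(* every step plays the same role on the event that the sum is positive *)
have exch (g : R -> R) i : measurable_fun setT g -> (forall x, 0 <= g x)%R ->
    \int[P]_w pos (g \o X i) w = \int[P]_w pos (g \o X ord0) w.
  move=> mg g0.
  pose F (x : 'I_n.+1 -> R) :=
    ((if (0 < \sum_i x i)%R then g (x i) else 0%R)%:E).
  have iY := iid_reindex (@perm_inj _ (tperm i ord0)) iX.
  have := @iid_ge0_integral _ _ _ _ _ _ _ _ F iX iY.
  have -> : \int[P]_w F (X^~ w) = \int[P]_w pos (g \o X i) w by [].
  move=> ->; last 2 first.
  + apply: (@measurable_pos_sum _ _ _ (fun i t => tnth t i)).
      by move=> j; exact: measurable_tnth.
    by apply: measurableT_comp => //; exact: measurable_tnth.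
  + by move=> x; rewrite /F; case: ifP => _; rewrite lee_fin.
  apply: eq_integral => w _; rewrite /F /pos /= tpermL.
  by rewrite [in RHS](reindex_inj (@perm_inj _ (tperm i ord0)))/=.
have E3 : n.+1%:R%:E * \int[P]_w pos (xp ord0) w =
    \int[P]_w (Num.max 0 (\sum_i X i w))%:E +
    n.+1%:R%:E * \int[P]_w pos (xm ord0) w.
  have sumE (x : 'I_n.+1 -> Omega -> R) :
      (forall i, \int[P]_w pos (x i) w = \int[P]_w pos (x ord0) w) ->
      (forall i, measurable_fun setT (x i)) -> (forall i w, 0 <= x i w)%R ->
      n.+1%:R%:E * \int[P]_w pos (x ord0) w =
      \int[P]_w (\sum_(i < n.+1) pos (x i) w).
    move=> xe mx x0; rewrite ge0_integral_sum//; last 2 first.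
    + by move=> i; exact: mpos.
    + by move=> i w _; rewrite pos0.
    rewrite (eq_bigr _ (fun i _ => xe i)) sumr_const card_ord.
    by rewrite mule_natl.
  rewrite !sumE//; last 2 first.
  - move=> i; apply: (exch (fun x => Num.max 0 (- x))%R) => [|x].
      by apply: measurable_maxr => //; exact: oppr_measurable.
    by rewrite le_max lexx.
  - move=> i; apply: (exch (fun x => Num.max 0 x)%R) => [|x].
      by apply: measurable_maxr.
    by rewrite le_max lexx.
  rewrite -ge0_integralD//; last 4 first.
  - by move=> w _; rewrite lee_fin le_max lexx.
  - by apply: mE; apply: measurable_maxr => //; exact: measurable_ord_sum.
  - by move=> w _; apply: sume_ge0 => i _; rewrite pos0.
  - by apply: emeasurable_sum => i; exact: mpos.
  apply: eq_integral => w _; rewrite /pos.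
  have [S0|S0] := ltP 0%R (\sum_i X i w)%R.
    rewrite !sumEFin -EFinD -big_split/=; congr EFin.
    apply: eq_bigr => i _; rewrite /xp /xm.
    by rewrite addr_maxr addr0 subrr maxC.
  by rewrite !big1// adde0.
have fin : \int[P]_w pos (xm ord0) w \is a fin_num.
  rewrite ge0_fin_numE; last by apply: integral_ge0 => w _; exact: pos0.
  apply: le_lt_trans X0fin; apply: ge0_le_integral => //.
  - by move=> w _; exact: pos0.
  - exact: mpos.
  - by apply: mE; exact: measurableT_comp.
  - move=> w _; rewrite lee_fin /xm; case: ifP => // _.
    by rewrite ge_max normr_ge0 -normrN ler_norm.
move: E1; rewrite -addeA E2 => E1; apply: (cancel_scaled_sum _ _ _ _ fin E1 E3).
all: by apply: integral_ge0 => w _; rewrite ?pos0 ?lee_fin.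
Qed.

End spitzer.

(** * First and second moments of the maximum of a walk *)

Section walk_moments.
Context d (Omega : measurableType d) (R : realType) (P : probability Omega R).
Context (nu : set R -> \bar R) (nu1 : nu setT = 1%E).
Local Open Scope ereal_scope.

(** Spitzer's identity. *)
Lemma spitzer (X : nat -> Omega -> R) n :
  (forall m, iid P nu (fun i : 'I_m => X i)) ->
  \int[P]_w `|X 0%N w|%:E < +oo ->
  \int[P]_w (ord_walk_max (fun i : 'I_n => X i w))%:E =
  \sum_(k < n) (k.+1%:R^-1)%:E *
    \int[P]_w (Num.max 0 (\sum_(i < k.+1) X i w))%:E.
Proof.
move=> iX X0; elim: n => [|n IH].
  rewrite big_ord0; apply: integral0_eq => w _.
  by rewrite /ord_walk_max enum_ord0.
rewrite big_ord_recr /= -IH.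
have := spitzer_step (iX n.+1) X0.
move=> /(congr1 (fun z => (n.+1%:R^-1)%:E * z)).
rewrite muleA -EFinM mulVf// mul1e => ->.
rewrite ge0_muleDr.
- by rewrite [X in _ + X]muleA -EFinM mulVf// mul1e addeC.
- by apply: integral_ge0 => w _; rewrite lee_fin le_max lexx.
- rewrite mule_ge0// ?lee_fin//.
  by apply: integral_ge0 => w _; rewrite lee_fin walk_max_ge0.
Qed.

(** The maximum of a walk is the positive part of its first step plus the
    maximum of the remaining walk; averaging over the sign of the first step
    removes the cross term of the square. *)
Lemma walk_max_second_moment n (X : 'I_n -> Omega -> R) (v : R) :
  (forall A : set R, measurable A -> nu (-%R @^-1` A) = nu A) ->
  iid P nu X -> (forall i, \int[P]_w ((X i w) ^+ 2)%:E <= v%:E) ->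
  \int[P]_w (ord_walk_max (X ^~ w) ^+ 2)%:E <= (n%:R * v)%:E.
Proof.
move=> nuN; elim: n X => [|n IH] X iX Xv.
  rewrite mul0r le_eqVlt; apply/orP; left; apply/eqP; apply: integral0_eq => w _.
  by rewrite /ord_walk_max enum_ord0 expr0n.
have [mX hX] := iX.
pose e (i : 'I_n.+1) := i == ord0.
have iY := iid_sign e nuN iX; have [mY hY] := iY.
pose Y := fun i w => ((-1) ^+ (e i) * X i w)%R.
pose Mt w := ord_walk_max (fun i : 'I_n => X (lift ord0 i) w).
have mMt : measurable_fun setT Mt.
  exact: (measurable_ord_walk_max (X := fun i : 'I_n => X (lift ord0 i))).
have YE w : (fun i : 'I_n => Y (lift ord0 i) w) = (fun i => X (lift ord0 i) w).
  by apply/funext => i; rewrite /Y /e /= expr0 mul1r.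
have Y0 w : Y ord0 w = (- X ord0 w)%R by rewrite /Y /e eqxx expr1 mulN1r.
have XY : \int[P]_w (ord_walk_max (X ^~ w) ^+ 2)%:E =
          \int[P]_w (ord_walk_max (Y ^~ w) ^+ 2)%:E.
  apply: (@iid_ge0_integral _ _ _ _ _ _ _ _
    (fun x => (ord_walk_max x ^+ 2)%:E) iX iY) => [|x].
    apply/measurable_EFinP/measurable_funX.
    apply: (measurable_ord_walk_max (X := fun i t => tnth t i)) => i.
    exact: measurable_tnth.
  by rewrite lee_fin sqr_ge0.
have mE (f : Omega -> R) : measurable_fun setT f ->
    measurable_fun setT (fun w => (f w ^+ 2)%:E).
  by move=> ?; apply/measurable_EFinP; exact: measurable_funX.
have mM (Z : 'I_n.+1 -> Omega -> R) : (forall i, measurable_fun setT (Z i)) ->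
    measurable_fun setT (fun w => (ord_walk_max (Z ^~ w) ^+ 2)%:E).
  by move=> mZ; apply: mE; exact: measurable_ord_walk_max.
have sq0 (f : Omega -> R) w : 0 <= (f w ^+ 2)%:E by rewrite lee_fin sqr_ge0.
rewrite -(@lee_pmul2l _ 2%:E)//.
apply: (@le_trans _ _ (2%:E * (\int[P]_w ((X ord0 w) ^+ 2)%:E +
                              \int[P]_w (Mt w ^+ 2)%:E))).
  rewrite [leLHS](_ : _ = \int[P]_w (ord_walk_max (X ^~ w) ^+ 2)%:E +
                          \int[P]_w (ord_walk_max (Y ^~ w) ^+ 2)%:E); last first.
    by rewrite -XY mule_natl mule2n.
  rewrite -!ge0_integralD//;
    try (by move=> w _; rewrite lee_fin sqr_ge0);
    try (exact: mM); try (exact: mE).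
  rewrite -ge0_integralZl//; last 2 first.
  - by apply: emeasurable_funD; exact: mE.
  - by move=> w _; rewrite adde_ge0.
  apply: ge0_le_integral => //.
  - by move=> w _; rewrite adde_ge0 ?lee_fin ?sqr_ge0.
  - by apply: emeasurable_funD; exact: mM.
  - apply: emeasurable_funM => //; by apply: emeasurable_funD; exact: mE.
  move=> w _; rewrite -!EFinD -EFinM lee_fin !ord_walk_maxSl YE Y0 -/(Mt w).
  have pos2 (x : R) : (Num.max 0 x ^+ 2 <= x ^+ 2)%R.
    by case: (leP 0%R x) => //; rewrite expr0n sqr_ge0.
  have := pos2 (X ord0 w + Mt w)%R; have := pos2 (- X ord0 w + Mt w)%R.
  set a := (Num.max _ _ ^+ 2)%R; set b := (Num.max _ _ ^+ 2)%R.
  nra.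
rewrite lee_pmul2l// -natr1 mulrDl mul1r addrC EFinD leeD//.
apply: IH => [|i]; last exact: Xv.
exact: (iid_drop nu1).
Qed.

End walk_moments.

(** * Moments of the normal distribution *)

Section density.
Context d (T : measurableType d) (R : realType).
Variables (mu nu : {measure set T -> \bar R}) (p : T -> R).
Hypothesis p0 : forall x, 0 <= p x.
Hypothesis mp : measurable_fun setT p.
Hypothesis nuE : forall A, measurable A ->
  nu A = (\int[mu]_(x in A) (p x)%:E)%E.
Local Open Scope ereal_scope.
Import HBNNSimple.

Local Lemma integral_density_nnsfun (f : {nnsfun T >-> R}) :
  \int[nu]_x (f x)%:E = \int[mu]_x ((f x)%:E * (p x)%:E).
Proof.
have mp' : measurable_fun setT (fun x => (p x)%:E) by exact/measurable_EFinP.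
under [LHS]eq_integral do rewrite fimfunE -fsumEFin//.
rewrite [LHS]ge0_integral_fsum//; last 2 first.
  - by move=> r; exact/measurable_EFinP/measurableT_comp.
  - by move=> n x _; rewrite EFinM nnfun_muleindic_ge0.
under [RHS]eq_integral.
  move=> x _; rewrite fimfunE -fsumEFin// muleC ge0_mule_fsumr; last first.
    by move=> r; rewrite EFinM nnfun_muleindic_ge0.
  over.
rewrite [RHS]ge0_integral_fsum//; last 2 first.
  - move=> r; apply: emeasurable_funM => //.
    by apply/measurable_EFinP; apply/measurableT_comp.
  - move=> n x _; apply: mule_ge0; first by rewrite lee_fin.
    by rewrite EFinM nnfun_muleindic_ge0.
apply: eq_fsbigr => r rf.
rewrite integralZl_indic_nnsfun// integral_indic// setIT nuE//.
have r0 : (0 <= r)%R by move: rf; rewrite inE => -[x _ <-].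
rewrite -ge0_integralZl//; last by move=> x _; rewrite lee_fin.
  rewrite [LHS]integral_mkcond; apply: eq_integral => x _.
  rewrite patchE indicE; case: ifPn => xr; first by rewrite mulr1 muleC.
  by rewrite mulr0 mule0.
exact: measurable_funTS.
Qed.

Lemma ge0_integral_density (f : T -> \bar R) :
  measurable_fun setT f -> (forall x, 0 <= f x) ->
  \int[nu]_x f x = \int[mu]_x (f x * (p x)%:E).
Proof.
move=> mf f0.
have mp' : measurable_fun setT (fun x => (p x)%:E) by exact/measurable_EFinP.
pose f_ := nnsfun_approx measurableT mf.
have f_cvg x : (f_ n x)%:E @[n --> \oo] --> f x.
  by apply: cvg_nnsfun_approx.
transitivity (lim (\int[nu]_x (f_ n x)%:E @[n --> \oo])).
  rewrite -monotone_convergence//=.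
  - by apply: eq_integral => x _; apply/esym/cvg_lim => //; exact: f_cvg.
  - by move=> n; exact/measurable_EFinP.
  - by move=> n ? _; rewrite lee_fin.
  - by move=> ? _ ? ? mn; rewrite lee_fin; exact/lefP/nd_nnsfun_approx.
transitivity (lim (\int[mu]_x ((f_ n x)%:E * (p x)%:E) @[n --> \oo])).
  by apply: congr_lim; apply/funext => n; rewrite integral_density_nnsfun.
rewrite -monotone_convergence//=.
- apply: eq_integral => x _; apply/cvg_lim => //.
  by apply: cvgeZr => //; exact: f_cvg.
- by move=> n; apply: emeasurable_funM => //; exact/measurable_EFinP.
- by move=> n x _; rewrite mule_ge0// lee_fin.
- move=> x _ m n mn; rewrite lee_wpmul2r ?lee_fin//.
  exact/lefP/nd_nnsfun_approx.
Qed.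

End density.

Section normal_moments.
Context (R : realType) (s : R) (s0 : 0 < s).
Local Notation mu := (@lebesgue_measure R).
Local Notation N := (normal_prob 0 s).

Lemma ge0_integral_normal_prob (f : R -> \bar R) :
  measurable_fun setT f -> (forall x, 0 <= f x)%E ->
  (\int[N]_x f x = \int[mu]_x (f x * (normal_pdf 0 s x)%:E))%E.
Proof.
move=> mf f0; apply: ge0_integral_density => //.
- by move=> x; exact: normal_pdf_ge0.
- exact: measurable_normal_pdf.
Qed.

Lemma normal_probN (A : set R) : measurable A -> N (-%R @^-1` A) = N A.
Proof.
move=> mA; pose f x := (normal_pdf 0 s x)%:E.
have fN x : f (- x) = f x.
  by rewrite /f !normal_pdfE ?gt_eqF// /normal_fun !subr0 sqrrN.
rewrite /normal_prob.
transitivity (\int[mu]_(x in (-%R : _ -> measurableTypeR R) @^-1` A) (f \o -%R) x)%E.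
  by apply: eq_integral => x _; rewrite /= fN.
rewrite -ge0_integral_pushforward//=.
- by apply: eq_measure_integral => //= B mB _; exact: lebesgue_measureN.
- by apply: measurable_funTS; apply/measurable_EFinP; exact: measurable_normal_pdf.
- by move=> x _; rewrite lee_fin normal_pdf_ge0.
Qed.

Lemma normal_peakE (t : R) : 0 < t ->
  normal_peak t = (t * Num.sqrt (2 * pi))^-1.
Proof.
move=> t0; rewrite /normal_peak -mulrnAr sqrtrM ?sqr_ge0// sqrtr_sqr gtr0_norm//.
by rewrite -[pi *+ 2]mulr_natl.
Qed.

(** On the positive half-line, x times the density is an exact derivative. *)
Lemma normal_pos_part :
  (\int[N]_x (Num.max 0 x)%:E = (s / Num.sqrt (2 * pi))%:E)%E.
Proof.
rewrite ge0_integral_normal_prob; last 2 first.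
- by apply/measurable_EFinP; apply: measurable_maxr.
- by move=> x; rewrite lee_fin le_max lexx.
have sn0 : s != 0 by rewrite gt_eqF.
pose k := (s ^+ 2 *+ 2)^-1.
have k0 : 0 < k by rewrite invr_gt0 pmulrn_lgt0// exprn_gt0.
pose f x := x * normal_pdf 0 s x.
pose F x := - (normal_peak s * s ^+ 2) * expR (- x ^+ 2 * k).
have fE x : f x = x * (normal_peak s * expR (- x ^+ 2 * k)).
  by rewrite /f normal_pdfE// /normal_fun subr0.
have dF (x : R) : is_derive x 1 F (f x).
  rewrite /F fE; apply: is_derive_eq.
  rewrite /GRing.scale /= /k; set E := expR _; field.
  exact: sn0.
have DF (x : R) : derivable F x 1 by case: (dF x).
have Fc (x : R) : F y @[y --> x] --> F x.
  by apply: differentiable_continuous; apply/derivable1_diffP.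
have -> : (\int[mu]_x ((Num.max 0 x)%:E * (normal_pdf 0 s x)%:E) =
    \int[mu]_(x in `[0%R, +oo[) (f x)%:E)%E.
  rewrite [RHS]integral_mkcond; apply: eq_integral => x _.
  rewrite patchE -EFinM; case: ifPn.
    by rewrite inE/= in_itv/= andbT => x0; rewrite (max_idPr x0).
  rewrite notin_setE/= in_itv/= andbT => /negP; rewrite -ltNge => x0.
  by rewrite (max_idPl (ltW x0)) mul0r.
rewrite (@ge0_continuous_FTC2y _ f F 0 0).
- rewrite /F expr0n oppr0 mul0r expR0 mulr1 sub0e EFinN oppeK.
  congr EFin; rewrite normal_peakE//.
  have q0 : Num.sqrt (2 * pi : R) != 0.
    by rewrite gt_eqF// sqrtr_gt0 mulr_gt0// pi_gt0.
  by field; rewrite q0.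
- by move=> x x0; rewrite mulr_ge0// normal_pdf_ge0.
- apply: continuous_subspaceT => x; apply: cvgM; first exact: cvg_id.
  exact: continuous_normal_pdf.
- rewrite -[X in _ --> X](mulr0 (- (normal_peak s * s ^+ 2))).
  apply: cvgM; first exact: cvg_cst.
  have -> : (fun x => expR (- x ^+ 2 * k)) =
      @gauss_fun R \o (fun x => x * Num.sqrt k).
    apply/funext => x; rewrite /gauss_fun /= exprMn sqr_sqrtr ?(ltW k0)//.
    by rewrite mulNr.
  apply: cvg_comp; last exact: cvg_gauss_fun.
  by apply: gt0_cvgMly; [rewrite sqrtr_gt0|exact: cvg_id].
- by move=> x _; exact: DF.
- exact: cvg_at_right_filter.
- by move=> x _; rewrite derive1E; exact: derive_val.
Qed.

(** A crude bound on the second moment: since t exp(-t) <= 1, x^2 times the density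
    is at most 4 sqrt(2) s^2 times the normal density of variance 2 s^2, which
    has integral 1; and 4 sqrt(2) <= 6. *)
Lemma normal_sq_le : (\int[N]_x (x ^+ 2)%:E <= (6 * s ^+ 2)%:E)%E.
Proof.
have sn0 : s != 0 by rewrite gt_eqF.
pose s' := Num.sqrt 2 * s.
have s'n0 : s' != 0 by rewrite mulf_neq0// gt_eqF// sqrtr_gt0.
have s'2 : s' ^+ 2 = 2 * s ^+ 2 by rewrite exprMn sqr_sqrtr.
have peakE : normal_peak s = Num.sqrt 2 * normal_peak s'.
  have ? : Num.sqrt 2 != 0 :> R by rewrite gt_eqF// sqrtr_gt0.
  have q0 : Num.sqrt (2 * pi : R) != 0.
    by rewrite gt_eqF// sqrtr_gt0 mulr_gt0// pi_gt0.
  rewrite !normal_peakE//; last by rewrite mulr_gt0// sqrtr_gt0.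
  by rewrite /s'; field; rewrite q0 sn0.
have mpdf t : measurable_fun setT (fun x : R => (normal_pdf 0 t x)%:E).
  by apply/measurable_EFinP; exact: measurable_normal_pdf.
rewrite ge0_integral_normal_prob; last 2 first.
- by apply/measurable_EFinP; apply: measurable_funX.
- by move=> x; rewrite lee_fin sqr_ge0.
have -> : (6 * s ^+ 2)%:E =
    (\int[mu]_x ((6 * s ^+ 2)%:E * (normal_pdf 0 s' x)%:E))%E.
  rewrite ge0_integralZl//; first by rewrite integral_normal_pdf mule1.
  - exact: mpdf.
  - by move=> x _; rewrite lee_fin normal_pdf_ge0.
  - by rewrite lee_fin mulr_ge0// sqr_ge0.
apply: ge0_le_integral => //.
- by move=> x _; rewrite mule_ge0// lee_fin ?sqr_ge0// normal_pdf_ge0.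
- apply: emeasurable_funM => //.
    by apply/measurable_EFinP; apply: measurable_funX.
  exact: mpdf.
- by apply: emeasurable_funM => //; exact: mpdf.
move=> x _; rewrite -!EFinM lee_fin !normal_pdfE// /normal_fun !subr0 peakE.
rewrite s'2.
have -> : - x ^+ 2 / (s ^+ 2 *+ 2) =
    - (x ^+ 2 / (4 * s ^+ 2)) + - x ^+ 2 / (2 * s ^+ 2 *+ 2).
  by field.
rewrite expRD; set E := expR (- x ^+ 2 / _); set t := x ^+ 2 / (4 * s ^+ 2).
have E0 : 0 <= E by exact: expR_ge0.
have p0 : 0 <= normal_peak s' by exact: normal_peak_ge0.
have s20 : 0 < s ^+ 2 by rewrite exprn_gt0.
have -> : x ^+ 2 = 4 * s ^+ 2 * t by rewrite /t; field.
have tE : t * expR (- t) <= 1.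
  rewrite expRN ler_pdivrMr ?expR_gt0// mul1r.
  by apply: le_trans (expR_ge1Dx t); rewrite lerDr.
have sq2 : 4 * Num.sqrt 2 <= 6 :> R.
  rewrite -ler_pdivlMl// -[leRHS]ger0_norm// -sqrtr_sqr ler_wsqrtr//.
  lra.
have -> : 4 * s ^+ 2 * t * (Num.sqrt 2 * normal_peak s' * (expR (- t) * E)) =
  (4 * Num.sqrt 2) * (t * expR (- t)) * (s ^+ 2 * (normal_peak s' * E)) by ring.
rewrite -[leRHS]mulrA ler_wpM2r//; first by rewrite !mulr_ge0// ltW.
by apply: le_trans sq2; rewrite ler_piMr// mulr_ge0.
Qed.

End normal_moments.

(** * A path read along a grid of times *)

Section grid.
Context (R : realType).
Implicit Types (f : R -> R) (a L : R).

Lemma within_itv_continuous_dist f a b s e :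
  {within `[a, b], continuous f} -> s \in `[a, b] -> 0 < e ->
  exists2 r, 0 < r &
    forall t, t \in `[a, b] -> `|s - t| < r -> `|f s - f t| <= e.
Proof.
move=> /subspace_continuousP cf sI e0.
have /cvgrPdist_le /(_ e e0) := cf s sI.
rewrite near_withinE => /nbhs_ballP[/= r r0 hr]; exists r => // t tI st.
exact: hr.
Qed.

(** The times that cut [[a, a + L]] into [n] equal parts; indices beyond [n]
    continue with the same mesh. *)
Definition grid a L n (i : nat) : R := a + i%:R * (L / n%:R).

Definition grid_step f a L n (i : nat) : R :=
  f (grid a L n i.+1) - f (grid a L n i).

Definition grid_max f a L n : R :=
  ord_walk_max (fun i : 'I_n => grid_step f a L n i).

Lemma grid0 a L n : grid a L n 0 = a.
Proof. by rewrite /grid mul0r addr0. Qed.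

Lemma grid_size a L n : (0 < n)%N -> grid a L n n = a + L.
Proof. by move=> n0; rewrite /grid mulrC divfK// pnatr_eq0 -lt0n. Qed.

Lemma grid_mem a L n k : 0 <= L -> (k <= n)%N -> grid a L n k \in `[a, a + L].
Proof.
move=> L0 kn; rewrite in_itv/= /grid lerDl lerD2l.
have [->|n0] := posnP n; first by rewrite invr0 !mulr0 lexx.
rewrite mulr_ge0 ?divr_ge0//=.
by rewrite mulrCA ler_piMr// ler_pdivrMr ?ltr0n// mul1r ler_nat.
Qed.

Lemma sum_grid_step f a L n k :
  \sum_(i < k) grid_step f a L n i = f (grid a L n k) - f a.
Proof.
rewrite -(big_mkord xpredT (grid_step f a L n)).
by rewrite telescope_sumr// grid0.
Qed.

Lemma grid_max_mkseq f a L n :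
  grid_max f a L n = walk_max (mkseq (grid_step f a L n) n).
Proof.
rewrite /grid_max /ord_walk_max /mkseq -val_enum_ord -map_comp.
by congr walk_max; exact: eq_map.
Qed.

Lemma sum_take_mkseq (y : nat -> R) n k : (k <= n)%N ->
  \sum_(x <- take k (mkseq y n)) x = \sum_(i < k) y i.
Proof.
move=> kn; rewrite /mkseq -map_take take_iota (minn_idPl kn) big_map.
by rewrite -[in iota _ k](subn0 k) big_mkord.
Qed.

Lemma grid_max_ge f a L n k : (k <= n)%N ->
  f (grid a L n k) - f a <= grid_max f a L n.
Proof.
move=> kn; rewrite -sum_grid_step -(sum_take_mkseq _ kn) grid_max_mkseq.
exact: walk_max_ge.
Qed.

Lemma grid_max_le f a L n c : 0 <= c ->
  (forall k, (k <= n)%N -> f (grid a L n k) - f a <= c) ->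
  grid_max f a L n <= c.
Proof.
move=> c0 h; rewrite grid_max_mkseq; apply: walk_max_le => // k.
by rewrite size_mkseq => kn; rewrite sum_take_mkseq// sum_grid_step h.
Qed.

Lemma grid_max_ge0 f a L n : 0 <= grid_max f a L n.
Proof. exact: walk_max_ge0. Qed.

(** Dyadic grids are nested. *)
Lemma nondecreasing_grid_max f a L :
  nondecreasing_seq (fun m => grid_max f a L (2 ^ m)).
Proof.
move=> m m' mm'; apply: grid_max_le => [|k km]; first exact: grid_max_ge0.
have -> : grid a L (2 ^ m) k = grid a L (2 ^ m') (k * 2 ^ (m' - m)).
  rewrite /grid natrM -{2}(subnKC mm') expnD natrM.
  have ? : (2 ^ m)%:R != 0 :> R by rewrite pnatr_eq0 expn_eq0.
  have ? : (2 ^ (m' - m))%:R != 0 :> R by rewrite pnatr_eq0 expn_eq0.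
  by field; apply/andP.
apply: grid_max_ge; rewrite -{2}(subnKC mm') expnD leq_mul2r km orbT//.
Qed.

(** Some point of the grid is within one mesh of a point where the path attains
    its maximum. *)
Lemma grid_max_cvg f a L s : 0 < L ->
  {within `[a, a + L], continuous f} ->
  s \in `[a, a + L] -> (forall t, t \in `[a, a + L] -> f t <= f s) ->
  grid_max f a L (2 ^ m) @[m --> \oo] --> f s - f a.
Proof.
move=> L0 cf sI smax.
have aI : a \in `[a, a + L] by rewrite in_itv/= lexx lerDl ltW.
have ub n : grid_max f a L n <= f s - f a.
  apply: grid_max_le => [|k kn]; first by rewrite subr_ge0 smax.
  by rewrite lerB// smax// grid_mem// ltW.
apply/cvgrPdist_le => /= e e0.
have [r r0 hr] := within_itv_continuous_dist cf sI e0.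
have [N _ hN] : \forall m \near \oo, L / r < (2 ^ m)%:R.
  have [N hN] : exists N : nat, L / r < N%:R.
    by exists (Num.truncn (L / r)).+1; rewrite truncnS_gt.
  exists N => // m /= Nm; apply: (lt_le_trans hN); rewrite ler_nat.
  by apply: (leq_trans Nm); apply/ltnW; exact: ltn_expl.
exists N => // m /= Nm.
rewrite ger0_norm ?subr_ge0 ?ub//.
have n0 : 0 < (2 ^ m)%:R :> R by rewrite ltr0n expn_gt0.
set h := L / (2 ^ m)%:R.
have h0 : 0 < h by rewrite divr_gt0.
have hr' : h < r by rewrite /h ltr_pdivrMr// mulrC -ltr_pdivrMr// hN.
pose k := Num.truncn ((s - a) / h).
move: sI; rewrite in_itv/= => /andP[as_ sL].
have sa0 : 0 <= (s - a) / h by rewrite divr_ge0 ?subr_ge0// ltW.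
have [k1 k2] : k%:R * h <= s - a /\ s - a < k.+1%:R * h.
  by rewrite -ler_pdivlMr// -ltr_pdivrMr// truncn_le// truncnS_gt.
have kn : (k <= 2 ^ m)%N.
  rewrite -(@ler_nat R) -(ler_pM2r h0); apply: (le_trans k1).
  by rewrite /h mulrC divfK ?gt_eqF//; lra.
have gE : grid a L (2 ^ m) k = a + k%:R * h by [].
have gI : grid a L (2 ^ m) k \in `[a, a + L] by rewrite grid_mem// ltW.
have hh : `|f s - f (grid a L (2 ^ m) k)| <= e.
  apply: hr => //; rewrite gE ger0_norm; last by lra.
  by move: k2; rewrite -natr1 mulrDl mul1r; lra.
have := @grid_max_ge f a L _ _ kn.
by move: hh; rewrite ger0_norm ?subr_ge0 ?smax//; lra.
Qed.

End grid.

(** * Brownian motion read along a grid of times *)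

Section brownian_walks.
Context d (Omega : measurableType d) (R : realType) (P : probability Omega R).
Implicit Type B : R -> {RV P >-> R}.

(** Statements about minima follow from those about maxima by this symmetry. *)
Lemma brownian_opp B : standard_brownian_motion B ->
  standard_brownian_motion (fun t => (\- B t)%R : {RV P >-> R}).
Proof.
move=> [B0 Bind Bgauss Bcont]; split.
- by apply: filterS B0 => w /= ->; rewrite oppr0.
- move=> n t t0 tmono A mA.
  have mN i : measurable (-%R @^-1` A i).
    by rewrite -[X in measurable X]setTI; exact: oppr_measurable.
  have E (i : 'I_n) : (fun w => (\- B (t i.+1)) w - (\- B (t i)) w) @^-1` A i =
     (fun w => B (t i.+1) w - B (t i) w) @^-1` (-%R @^-1` A i).
    by apply/seteqP; split=> w /=; rewrite opprB opprK addrC.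
  have := Bind n t t0 tmono _ mN.
  move=> h; transitivity (\prod_(i < n) P ((fun w => (B (t i.+1) w - B (t i) w)%R) @^-1`
      (-%R @^-1` A i)))%E.
    by rewrite -h; congr (P _); apply: eq_bigcapr => i _; rewrite E.
  by apply: eq_bigr => i _; rewrite E.
- move=> s t s0 st A mA.
  have mN : measurable (-%R @^-1` A).
    by rewrite -[X in measurable X]setTI; exact: oppr_measurable.
  rewrite -normal_probN ?sqrtr_gt0 ?subr_gt0// -(Bgauss s t s0 st _ mN).
  by congr (P _); apply/seteqP; split=> w /=; rewrite opprB opprK addrC.
- apply: filterS Bcont => w /= cw x.
  by apply: (@cvgN _ R^o); exact: cw.
Qed.

Lemma integral_brownian_increment B s t (g : R -> \bar R) :
  standard_brownian_motion B -> 0 <= s -> s < t ->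
  measurable_fun setT g -> (forall x, 0 <= g x)%E ->
  (\int[P]_w g (B t w - B s w)%R =
   \int[normal_prob 0 (Num.sqrt (t - s))]_x g x)%E.
Proof.
move=> hB s0 st mg g0.
pose D : Omega -> measurableTypeR R := fun w => B t w - B s w.
have mD : measurable_fun setT D by exact: measurable_funB.
pose D' : {mfun Omega >-> measurableTypeR R} := mfun_Sub (mem_set mD).
transitivity (\int[distribution P D']_x g x)%E.
  by rewrite ge0_integral_distribution.
apply: (@eq_measure_integral _ _ _ setT (normal_prob 0 (Num.sqrt (t - s)))
  (distribution P D')) => A mA _.
exact: (brownian_gaussian_increments hB s0 st mA).
Qed.

Lemma grid_succ (a L : R) n i : grid a L n i.+1 - grid a L n i = L / n%:R.
Proof. by rewrite /grid -natr1; ring. Qed.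

Lemma grid_ge0 (a L : R) n i : 0 <= a -> 0 <= L -> 0 <= grid a L n i.
Proof. by move=> a0 L0; rewrite addr_ge0// mulr_ge0// divr_ge0. Qed.

Lemma brownian_grid_iid B a L n m :
  standard_brownian_motion B -> 0 <= a -> 0 < L -> (0 < n)%N ->
  iid P (normal_prob 0 (Num.sqrt (L / n%:R)))
    (fun (i : 'I_m) w => grid_step (fun t => B t w) a L n i).
Proof.
move=> hB a0 L0 n0.
have h0 : 0 < L / n%:R by rewrite divr_gt0// ltr0n.
split=> [i|A mA]; first exact: measurable_funB.
have := brownian_independent_increments hB (n := m) (t := grid a L n) _ _ mA.
move=> ->.
- apply: eq_bigr => i _.
  have := brownian_gaussian_increments hB (s := grid a L n i)
    (t := grid a L n i.+1) _ _ (mA i).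
  rewrite grid_succ; apply; first by rewrite grid_ge0// ltW.
  by rewrite -subr_gt0 grid_succ.
- by rewrite grid0.
- by move=> i _; rewrite -subr_ge0 grid_succ ltW.
Qed.

Lemma measurable_grid_max B a L n :
  measurable_fun setT (fun w => grid_max (fun t => B t w) a L n).
Proof.
apply: (measurable_ord_walk_max
  (X := fun (i : 'I_n) w => grid_step (fun t => B t w) a L n i)) => i.
exact: measurable_funB.
Qed.

(** Spitzer's identity: the partial sums of the steps are increments of the path,
    whose positive parts have known expectations. *)
Lemma expectation_grid_max B a L n :
  standard_brownian_motion B -> 0 <= a -> 0 < L -> (0 < n)%N ->
  (\int[P]_w (grid_max (fun t => B t w) a L n)%:E =
   (Num.sqrt (L / (2 * pi)) *
     ((Num.sqrt n%:R)^-1 * \sum_(k < n) (Num.sqrt k.+1%:R)^-1))%:E)%E.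
Proof.
move=> hB a0 L0 n0.
have h0 : 0 < L / n%:R by rewrite divr_gt0// ltr0n.
pose X i w := grid_step (fun t => B t w) a L n i.
have incr i w : \sum_(j < i) X j w = B (grid a L n i) w - B a w.
  by rewrite sum_grid_step.
have gE i : grid a L n i - a = i%:R * (L / n%:R) by rewrite /grid; ring.
have g0 i : a < grid a L n i.+1.
  by rewrite -subr_gt0 gE mulr_gt0// ltr0n.
rewrite (@spitzer _ _ _ _ (normal_prob 0 (Num.sqrt (L / n%:R))) X n).
- rewrite mulr_sumr mulr_sumr -sumEFin; apply: eq_bigr => k _.
  under eq_integral do rewrite incr.
  rewrite (integral_brownian_increment (g := fun x => (Num.max 0 x)%:E) hB)//.
  + rewrite normal_pos_part; last by rewrite sqrtr_gt0 subr_gt0.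
    rewrite -EFinM gE; congr EFin.
    have k0 : 0 < k.+1%:R :> R by rewrite ltr0n.
    have n0' : 0 < n%:R :> R by rewrite ltr0n.
    have q0 : Num.sqrt (2 * pi : R) != 0.
      by rewrite gt_eqF// sqrtr_gt0 mulr_gt0// pi_gt0.
    have sn : Num.sqrt n%:R != 0 :> R by rewrite gt_eqF// sqrtr_gt0.
    have sk : Num.sqrt k.+1%:R != 0 :> R by rewrite gt_eqF// sqrtr_gt0.
    rewrite sqrtrM ?ler0n// !(sqrtrM _ (ltW L0)) !sqrtrV ?ler0n//; last first.
      by rewrite mulr_ge0// ltW// pi_gt0.
    have kE : k.+1%:R^-1 = (Num.sqrt k.+1%:R)^-1 * (Num.sqrt k.+1%:R)^-1 :> R.
      by rewrite -invfM -expr2 sqr_sqrtr// ltW.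
    by rewrite kE; field; rewrite q0 sn sk.
  + by apply/measurable_EFinP; exact: measurable_maxr.
  + by move=> x; rewrite lee_fin le_max lexx.
- by move=> m; exact: brownian_grid_iid.
have -> : (\int[P]_w `|X 0%N w|%:E =
    \int[P]_w `|B (grid a L n 1) w - B (grid a L n 0) w|%R%:E)%E by [].
rewrite (integral_brownian_increment (g := fun x => `|x|%:E) hB)//.
- rewrite grid_succ; apply: (@le_lt_trans _ _
     (\int[normal_prob 0 (Num.sqrt (L / n%:R))]_x (1 + (x ^+ 2)%:E))%E).
    apply: ge0_le_integral => //.
    - by apply/measurable_EFinP; exact: normr_measurable.
    - apply: emeasurable_funD => //.
      by apply/measurable_EFinP; exact: measurable_funX.
    - move=> x _; rewrite -EFinD lee_fin -real_normK ?num_real//.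
      by have := normr_ge0 x; set y := `|x|; nra.
  rewrite ge0_integralD//.
  + rewrite integral_cst// mul1e; apply: lte_add_pinfty.
      by rewrite [ltLHS](_ : _ = 1%E) ?ltry//; exact: integral_normal_pdf.
    apply: le_lt_trans (ltry _); apply: normal_sq_le.
    by rewrite sqrtr_gt0.
  + by move=> x _; rewrite lee_fin sqr_ge0.
  + by apply/measurable_EFinP; exact: measurable_funX.
- by rewrite grid0.
- by rewrite grid0.
- by apply/measurable_EFinP; exact: normr_measurable.
Qed.

Lemma second_moment_grid_max B a L n :
  standard_brownian_motion B -> 0 <= a -> 0 < L -> (0 < n)%N ->
  (\int[P]_w (grid_max (fun t => B t w) a L n ^+ 2)%:E <= (6 * L)%:E)%E.
Proof.
move=> hB a0 L0 n0.
have h0 : 0 < L / n%:R by rewrite divr_gt0// ltr0n.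
have s0 : 0 < Num.sqrt (L / n%:R) by rewrite sqrtr_gt0.
have -> : 6 * L = n%:R * (6 * (Num.sqrt (L / n%:R) ^+ 2)).
  by rewrite sqr_sqrtr ?ltW//; field; rewrite pnatr_eq0 -lt0n.
apply: (walk_max_second_moment _ _ (brownian_grid_iid n hB a0 L0 n0)).
- exact: probability_setT.
- by move=> A mA; exact: normal_probN.
- move=> i; rewrite /grid_step.
  rewrite (integral_brownian_increment (g := fun x => (x ^+ 2)%:E) hB)//.
  + by rewrite grid_succ; exact: normal_sq_le.
  + by rewrite grid_ge0// ltW.
  + by rewrite -subr_gt0 grid_succ.
  + by apply/measurable_EFinP; exact: measurable_funX.
  + by move=> x; rewrite lee_fin sqr_ge0.
Qed.

End brownian_walks.

(** * Independence of two blocks of variables *)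

Section blocks.
Context d (Omega : measurableType d) (R : realType) (P : probability Omega R).
Local Open Scope ereal_scope.

(** The product rule extends from boxes to all measurable events, first in one
    block and then in the other, so the joint law is a product measure and
    Tonelli's theorem applies. *)
Lemma block_independence n m (X : 'I_n -> Omega -> R) (Y : 'I_m -> Omega -> R)
    (F : ('I_n -> R) -> \bar R) (G : ('I_m -> R) -> \bar R) :
  (forall i, measurable_fun setT (X i)) ->
  (forall i, measurable_fun setT (Y i)) ->
  (forall A B, (forall i, measurable (A i)) -> (forall i, measurable (B i)) ->
    P (\bigcap_(i in [set: 'I_n]) (X i @^-1` A i) `&`
       \bigcap_(i in [set: 'I_m]) (Y i @^-1` B i)) =
    P (\bigcap_(i in [set: 'I_n]) (X i @^-1` A i)) *
    P (\bigcap_(i in [set: 'I_m]) (Y i @^-1` B i))) ->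
  measurable_fun [set: n.-tuple R] (fun t => F (tnth t)) ->
  measurable_fun [set: m.-tuple R] (fun t => G (tnth t)) ->
  (forall x, 0 <= F x) -> (forall x, 0 <= G x) ->
  \int[P]_w (F (X ^~ w) * G (Y ^~ w)) =
  \int[P]_w F (X ^~ w) * \int[P]_w G (Y ^~ w).
Proof.
move=> mX mY XY mF mG F0 G0.
have mtX := measurable_tuple_of_family mX.
have mtY := measurable_tuple_of_family mY.
pose X' : {mfun Omega >-> n.-tuple R} := mfun_Sub (mem_set mtX).
pose Y' : {mfun Omega >-> m.-tuple R} := mfun_Sub (mem_set mtY).
have mXY : measurable_fun setT (fun w => (X' w, Y' w)).
  by apply: measurable_fun_pair; exact: measurable_funPT.
pose XY' : {mfun Omega >-> (n.-tuple R * m.-tuple R)%type} :=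
  mfun_Sub (mem_set mXY).
have fin (E : set Omega) : measurable E -> (fine (P E))%:E = P E.
  by move=> mE; rewrite fineK// fin_num_measure.
(* first let the event on X range over all measurable sets, then the one on Y *)
have step1 A B : measurable A -> (forall i, measurable (B i)) ->
    P (X' @^-1` A `&` Y' @^-1` tuple_box B) =
    P (X' @^-1` A) * P (Y' @^-1` tuple_box B).
  move=> mA mB.
  have mbox : measurable (tuple_box B).
    by rewrite measurable_tuple_boxes; apply: sub_sigma_algebra; exists B.
  have mE : measurable (Y' @^-1` tuple_box B) by exact: measurable_funPTI.
  pose r : {nonneg R} := NngNum (fine_ge0 (measure_ge0 P (Y' @^-1` tuple_box B))).
  transitivity (mscale r (distribution P X') A); last first.
    by rewrite /mscale /= fin// muleC.
  apply: (@tuple_measure_unique R n (pushforward (mrestr P mE) X')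
    (mscale r (distribution P X'))) => //.
    rewrite -[ltLHS]/(P (setT `&` Y' @^-1` tuple_box B)) setTI.
    by rewrite (le_lt_trans (probability_le1 _ _))// ltry.
  move=> A' mA'.
  rewrite -[RHS]/((fine (P (Y' @^-1` tuple_box B)))%:E *
    P (X' @^-1` tuple_box A')) fin//.
  rewrite -[LHS]/(P (X' @^-1` tuple_box A' `&` Y' @^-1` tuple_box B)).
  by rewrite !(preimage_tuple_box X) !(preimage_tuple_box Y) XY// muleC.
have step2 A B : measurable A -> measurable B ->
    P (X' @^-1` A `&` Y' @^-1` B) = P (X' @^-1` A) * P (Y' @^-1` B).
  move=> mA mB.
  have mE : measurable (X' @^-1` A) by exact: measurable_funPTI.
  pose r : {nonneg R} := NngNum (fine_ge0 (measure_ge0 P (X' @^-1` A))).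
  transitivity (mscale r (distribution P Y') B); last by rewrite /mscale /= fin.
  rewrite setIC.
  apply: (@tuple_measure_unique R m (pushforward (mrestr P mE) Y')
    (mscale r (distribution P Y'))) => //.
    rewrite -[ltLHS]/(P (setT `&` X' @^-1` A)) setTI.
    by rewrite (le_lt_trans (probability_le1 _ _))// ltry.
  move=> B' mB'.
  rewrite -[RHS]/((fine (P (X' @^-1` A)))%:E *
    P (Y' @^-1` tuple_box B')) fin//.
  rewrite -[LHS]/(P (Y' @^-1` tuple_box B' `&` X' @^-1` A)).
  by rewrite setIC step1.
have tE k (Z : 'I_k -> Omega -> R) w : tnth (tuple_of_family Z w) = Z ^~ w.
  by apply/funext => i; rewrite tnth_mktuple.
pose f (t : n.-tuple R) := F (tnth t); pose g (t : m.-tuple R) := G (tnth t).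
have f0 t : 0 <= f t by exact: F0.
have g0 t : 0 <= g t by exact: G0.
pose h (z : n.-tuple R * m.-tuple R) := f z.1 * g z.2.
have mh : measurable_fun setT h.
  apply: emeasurable_funM.
    exact: (measurableT_comp mF measurable_fst).
  exact: (measurableT_comp mG measurable_snd).
have h0 z : 0 <= h z by rewrite mule_ge0.
transitivity (\int[distribution P XY']_z h z).
  rewrite ge0_integral_distribution//; apply: eq_integral => w _.
  by rewrite /h /f /g /= !tE.
transitivity (\int[distribution P X' \x distribution P Y']_z h z).
  apply: eq_measure_integral => A mA _; apply/esym.
  by apply: product_measure_unique => // C D mC mD; exact: step2.
rewrite fubini_tonelli1// /fubini_F /h /=.
under eq_integral do rewrite ge0_integralZl//.
rewrite ge0_integralZr//; last by apply: integral_ge0.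
rewrite !ge0_integral_distribution//.
by congr (_ * _); apply: eq_integral => w _; rewrite /f /g /= tE.
Qed.

Lemma ae_monotone_convergence (g : nat -> Omega -> \bar R) (Z : Omega -> \bar R) :
  (forall m, measurable_fun setT (g m)) -> (forall m w, 0 <= g m w) ->
  (forall w, nondecreasing_seq (g ^~ w)) ->
  measurable_fun setT Z -> {ae P, forall w, g m w @[m --> \oo] --> Z w} ->
  \int[P]_w g m w @[m --> \oo] --> \int[P]_w Z w.
Proof.
move=> mg g0 gnd mZ gZ.
have := @cvg_monotone_convergence _ _ _ P setT measurableT g mg
  (fun m w _ => g0 m w) (fun w _ m n mn => gnd w m n mn).
suff -> : \int[P]_w Z w = \int[P]_w limn (g ^~ w) by [].
apply: ae_eq_integral => //.
- apply: (emeasurable_fun_cvg g) => // w _.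
  by apply: ereal_nondecreasing_is_cvgn => m n mn; exact: gnd.
- by apply: filterS gZ => w gZw _; apply/esym/cvg_lim.
Qed.

End blocks.

(** * The oscillation of a path over an interval *)

Section oscillation.
Context (R : realType).
Implicit Types (f : R -> R) (a b L : R).

Definition osc f a b : R := sup (f @` `[a, b]) - inf (f @` `[a, b]).

Lemma osc_extrema f a b : a <= b -> {within `[a, b], continuous f} ->
  exists s t, [/\ s \in `[a, b], t \in `[a, b],
    forall x, x \in `[a, b] -> f t <= f x <= f s & osc f a b = f s - f t].
Proof.
move=> ab cf.
have [s sI smax] := EVT_max ab cf; have [t tI tmin] := EVT_min ab cf.
exists s, t; split => //; first by move=> x xI; rewrite tmin// smax.
rewrite /osc; congr (_ - _).
  apply/eqP; rewrite eq_le; apply/andP; split.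
    apply: ge_sup; first by exists (f s), s.
    by move=> _ [x xI <-]; exact: smax.
  apply: ub_le_sup; last by exists s.
  by exists (f s) => _ [x xI <-]; exact: smax.
apply/eqP; rewrite eq_le; apply/andP; split.
  apply: ge_inf; last by exists t.
  by exists (f t) => _ [x xI <-]; exact: tmin.
apply: lb_le_inf; first by exists (f t), t.
by move=> _ [x xI <-]; exact: tmin.
Qed.

Lemma osc_ge0 f a b : a <= b -> {within `[a, b], continuous f} -> 0 <= osc f a b.
Proof.
move=> ab cf; have [s [t [sI tI h ->]]] := osc_extrema ab cf.
by rewrite subr_ge0; case/andP: (h s sI).
Qed.

(** The walk of the opposite path accounts for the minimum. *)
Definition grid_range f a L m : R :=
  grid_max f a L (2 ^ m) + grid_max (fun t => - f t) a L (2 ^ m).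

Lemma grid_range_ge0 f a L m : 0 <= grid_range f a L m.
Proof. by rewrite addr_ge0// grid_max_ge0. Qed.

Lemma nondecreasing_grid_range f a L : nondecreasing_seq (grid_range f a L).
Proof. by move=> m n mn; rewrite lerD// nondecreasing_grid_max. Qed.

Lemma grid_range_cvg f a L : 0 < L -> {within `[a, a + L], continuous f} ->
  grid_range f a L m @[m --> \oo] --> osc f a (a + L).
Proof.
move=> L0 cf; have aL : a <= a + L by rewrite lerDl ltW.
have [s [t [sI tI h ->]]] := osc_extrema aL cf.
have -> : f s - f t = (f s - f a) + (- f t - - f a) by ring.
apply: cvgD.
  by apply: grid_max_cvg => // x xI; case/andP: (h x xI).
apply: (@grid_max_cvg _ (fun x => - f x)) => //.
  by move=> x; apply: cvgN; exact: cf.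
by move=> x xI; rewrite lerN2; case/andP: (h x xI).
Qed.

End oscillation.

Section inv_sqrt_sum.
Context (R : realType).

(** 1/sqrt(k+1) lies between 2 (sqrt(k+2) - sqrt(k+1)) and
    2 (sqrt(k+1) - sqrt(k)), and both bounds telescope. *)
Lemma inv_sqrt_sum_bounds n :
  2 * (Num.sqrt (n.+1%:R : R) - 1) <=
    \sum_(k < n) (Num.sqrt (k.+1%:R : R))^-1 <= 2 * Num.sqrt (n%:R : R).
Proof.
have q0 k : 0 < Num.sqrt k.+1%:R :> R by rewrite sqrtr_gt0.
have q2 k : Num.sqrt k%:R ^+ 2 = k%:R :> R by rewrite sqr_sqrtr.
elim: n => [|n /andP[IH1 IH2]].
  by rewrite big_ord0 sqrtr1 subrr sqrtr0 mulr0 lexx.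
rewrite big_ord_recr /=; set S := \sum_(k < n) _ in IH1 IH2 *.
have q1 := q0 n; have q3 := q0 n.+1.
have r0 : 0 <= Num.sqrt n%:R :> R by exact: sqrtr_ge0.
have e1 := q2 n; have e2 := q2 n.+1; have e3 := q2 n.+2.
set x := Num.sqrt n%:R in r0 e1 IH2; set y := Num.sqrt n.+1%:R in q1 e2 IH1 *.
set z := Num.sqrt n.+2%:R in q3 e3 *.
have zy : z ^+ 2 = y ^+ 2 + 1 by rewrite e3 e2 natr1.
have yx : y ^+ 2 = x ^+ 2 + 1 by rewrite e1 e2 natr1.
have iy : y * y^-1 = 1 by rewrite divff// gt_eqF.
apply/andP; split.
  have : 2 * (z - y) <= y^-1.
    by rewrite -(ler_pM2l q1) iy; have := sqr_ge0 (z - y); nra.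
  by move=> ?; lra.
have : y^-1 <= 2 * (y - x).
  by rewrite -(ler_pM2l q1) iy; have := sqr_ge0 (y - x); nra.
by move=> ?; lra.
Qed.

Lemma inv_sqrt_sum_cvg :
  (Num.sqrt ((2 ^ m)%:R : R))^-1 *
    \sum_(k < 2 ^ m) (Num.sqrt (k.+1%:R : R))^-1 @[m --> \oo] --> (2 : R).
Proof.
pose q (m : nat) : R := (Num.sqrt (2 ^ m)%:R)^-1.
have q0 m : 0 < q m by rewrite invr_gt0 sqrtr_gt0 ltr0n expn_gt0.
have qc : q m @[m --> \oo] --> (0 : R).
  have -> : q = (fun m => (Num.sqrt 2)^-1 ^+ m).
    apply/funext => m; rewrite /q natrX exprVn; congr (_^-1).
    elim: m => [|m IH]; first by rewrite !expr0 sqrtr1.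
    by rewrite !exprS sqrtrM// IH.
  apply: cvg_expr; rewrite ger0_norm ?invr_ge0 ?sqrtr_ge0//.
  rewrite invf_lt1 ?sqrtr_gt0// -[ltLHS]sqrtr1 ltr_sqrt//; lra.
apply: (@squeeze_cvgr _ _ _ _ (fun m => 2 - 2 * q m) (fun=> 2)).
- near=> m; have /andP[h1 h2] := inv_sqrt_sum_bounds (2 ^ m).
  have qq : q m * Num.sqrt (2 ^ m)%:R = 1.
    by rewrite mulVf// gt_eqF// sqrtr_gt0 ltr0n expn_gt0.
  have mono : Num.sqrt (2 ^ m)%:R <= Num.sqrt (2 ^ m).+1%:R :> R.
    by rewrite ler_wsqrtr// ler_nat.
  have := q0 m; rewrite -/(q m); move: (q m) qq => r qq r0.
  move: h1 h2 mono qq.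
  set S := \sum_(k < _) _; set y := Num.sqrt _.+1%:R; set x := Num.sqrt _.
  move=> h1 h2 mono qq.
  have a1 : r * (2 * (y - 1)) <= r * S by rewrite ler_wpM2l// ltW.
  have a2 : r * S <= r * (2 * x) by rewrite ler_wpM2l// ltW.
  have a3 : r * x <= r * y by rewrite ler_wpM2l// ltW.
  by apply/andP; split; nra.
- rewrite -[X in _ --> X](subr0 2) -[X in _ - X](mulr0 2).
  by apply: cvgB; [exact: cvg_cst|apply: cvgM => //; exact: cvg_cst].
- exact: cvg_cst.
Unshelve. all: by end_near. Qed.

End inv_sqrt_sum.

(** * The oscillation of Brownian motion along dyadic grids *)

Section brownian_osc.
Context d (Omega : measurableType d) (R : realType) (P : probability Omega R).
Context (B : R -> {RV P >-> R}) (hB : standard_brownian_motion B).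
Local Notation path w := (fun t => B t w).

Lemma measurable_grid_range a L m :
  measurable_fun setT (fun w => grid_range (path w) a L m).
Proof.
apply: measurable_funD; first exact: measurable_grid_max.
exact: (measurable_grid_max (fun t => (\- B t)%R : {RV P >-> R})).
Qed.

Lemma expectation_grid_range_cvg a L : 0 <= a -> 0 < L ->
  (\int[P]_w (grid_range (path w) a L m)%:E)%E @[m --> \oo] -->
  (4 * Num.sqrt (L / (2 * pi)))%:E.
Proof.
move=> a0 L0.
pose u m : R := (Num.sqrt ((2 ^ m)%:R : R))^-1 *
  \sum_(k < 2 ^ m) (Num.sqrt (k.+1%:R : R))^-1.
have -> : (fun m => (\int[P]_w (grid_range (path w) a L m)%:E)%E) =
   (fun m => (2 * Num.sqrt (L / (2 * pi)) * u m)%:E).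
  apply/funext => m; under eq_integral do rewrite EFinD.
  have n0 : (0 < 2 ^ m)%N by rewrite expn_gt0.
  rewrite ge0_integralD//; last 4 first.
  - by move=> w _; rewrite lee_fin grid_max_ge0.
  - by apply/measurable_EFinP; exact: measurable_grid_max.
  - by move=> w _; rewrite lee_fin grid_max_ge0.
  - apply/measurable_EFinP.
    exact: (measurable_grid_max (fun t => (\- B t)%R : {RV P >-> R})).
  rewrite (expectation_grid_max hB)//.
  rewrite (expectation_grid_max (brownian_opp hB))//.
  by rewrite -EFinD /u; congr EFin; ring.
apply: cvg_EFin; first by near=> m.
have -> : 4 * Num.sqrt (L / (2 * pi)) = 2 * Num.sqrt (L / (2 * pi)) * 2 by ring.
apply: cvgM; first exact: cvg_cst.
exact: inv_sqrt_sum_cvg.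
Unshelve. all: by end_near. Qed.

Lemma second_moment_grid_range a L m : 0 <= a -> 0 < L ->
  (\int[P]_w (grid_range (path w) a L m ^+ 2)%:E <= (24 * L)%:E)%E.
Proof.
move=> a0 L0; have n0 : (0 < 2 ^ m)%N by rewrite expn_gt0.
pose M1 w := grid_max (path w) a L (2 ^ m).
pose M2 w := grid_max (fun t => - B t w) a L (2 ^ m).
have mM1 : measurable_fun setT M1 by exact: measurable_grid_max.
have mM2 : measurable_fun setT M2.
  exact: (measurable_grid_max (fun t => (\- B t)%R : {RV P >-> R})).
have mE (f : Omega -> R) : measurable_fun setT f ->
    measurable_fun setT (fun w => (f w ^+ 2)%:E).
  by move=> mf; apply/measurable_EFinP; exact: measurable_funX.
apply: (@le_trans _ _ (2%:E * (\int[P]_w (M1 w ^+ 2)%:E +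
                               \int[P]_w (M2 w ^+ 2)%:E))%E).
  rewrite -ge0_integralD//; last 4 first.
  - by move=> w _; rewrite lee_fin sqr_ge0.
  - exact: mE.
  - by move=> w _; rewrite lee_fin sqr_ge0.
  - exact: mE.
  rewrite -ge0_integralZl//; last 2 first.
  - by apply: emeasurable_funD; exact: mE.
  - by move=> w _; rewrite adde_ge0// lee_fin sqr_ge0.
  apply: ge0_le_integral => //.
  - by move=> w _; rewrite lee_fin sqr_ge0.
  - by apply: mE; exact: measurable_grid_range.
  - by apply: emeasurable_funM => //; apply: emeasurable_funD; exact: mE.
  move=> w _; rewrite -EFinD -EFinM lee_fin /grid_range -/(M1 w) -/(M2 w).
  by have := sqr_ge0 (M1 w - M2 w); nra.
have -> : (24 * L)%:E = (2%:E * ((6 * L)%:E + (6 * L)%:E))%E.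
  by rewrite -EFinD -EFinM; congr EFin; ring.
rewrite lee_pmul2l//; apply: leeD; first exact: second_moment_grid_max.
exact: (second_moment_grid_max (brownian_opp hB)).
Qed.

(** The two grids form one increasing sequence of times, in which the gap between
    the intervals is a single increment, subject to no condition. *)
Lemma grid_range_independence a L a' L' m c : 0 <= a -> 0 < L -> 0 < L' ->
  a + L <= a' -> 0 <= c ->
  (\int[P]_w ((grid_range (path w) a L m + c)%:E *
              (grid_range (path w) a' L' m + c)%:E) =
   \int[P]_w (grid_range (path w) a L m + c)%:E *
   \int[P]_w (grid_range (path w) a' L' m + c)%:E)%E.
Proof.
move=> a0 L0 L'0 aa' c0.
set n := (2 ^ m)%N; have n0 : (0 < n)%N by rewrite expn_gt0.
have a'0 : 0 <= a' by lra.
pose X (i : 'I_n) w := grid_step (path w) a L n i.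
pose Y (i : 'I_n) w := grid_step (path w) a' L' n i.
have mX i : measurable_fun setT (X i) by exact: measurable_funB.
have mY i : measurable_fun setT (Y i) by exact: measurable_funB.
pose F (x : 'I_n -> R) :=
  ((ord_walk_max x + ord_walk_max (fun i => - x i) + c)%:E).
have F0 x : (0 <= F x)%E.
  by rewrite lee_fin !addr_ge0//; exact: walk_max_ge0.
have mF : measurable_fun [set: n.-tuple R] (fun t => F (tnth t)).
  apply/measurable_EFinP; apply: measurable_funD => //.
  apply: measurable_funD.
    apply: (measurable_ord_walk_max (X := fun i t => tnth t i)) => i.
    exact: measurable_tnth.
  apply: (measurable_ord_walk_max 
    (X := fun (i : 'I_n) (t : n.-tuple R) => (- tnth t i : R))) => i.
  by apply: measurableT_comp => //; exact: measurable_tnth.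
have FE (f : R -> R) b l :
    F (fun i : 'I_n => grid_step f b l n i) = (grid_range f b l m + c)%:E.
  rewrite /F /grid_range /grid_max; congr (_ + _ + _)%:E.
  by congr ord_walk_max; apply/funext => i; rewrite /grid_step; ring.
have XY (A C : 'I_n -> set R) :
    (forall i, measurable (A i)) -> (forall i, measurable (C i)) ->
    P (\bigcap_(i in [set: 'I_n]) (X i @^-1` A i) `&`
       \bigcap_(i in [set: 'I_n]) (Y i @^-1` C i)) =
    (P (\bigcap_(i in [set: 'I_n]) (X i @^-1` A i)) *
     P (\bigcap_(i in [set: 'I_n]) (Y i @^-1` C i)))%E.
  move=> mA mC.
  pose t (i : nat) := if (i <= n)%N then grid a L n i else grid a' L' n (i - n.+1).
  have t0 : 0 <= t 0%N by rewrite /t leq0n grid0.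
  have tmono i : (i < n + (1 + n))%N -> t i <= t i.+1.
    move=> _; rewrite /t; have [ltin|] := ltnP i n.
      by rewrite ltnW// -subr_ge0 grid_succ divr_ge0// ltW.
    rewrite leq_eqVlt => /orP[/eqP <-|ni].
      by rewrite leqnn subnn grid0 grid_size.
    rewrite leqNgt ni /= subSn//.
    by rewrite -subr_ge0 grid_succ divr_ge0// ltW.
  (* index n is the increment over the gap between the two intervals *)
  pose D (i : 'I_(n + (1 + n))) : set R :=
    match fintype.split i with
    | inl j => A j
    | inr k => if fintype.split k is inr j then C j else setT
    end.
  have Dl j : D (lshift _ j) = A j by rewrite /D (unsplitK (inl j)).
  have Dm j : D (rshift n (lshift n j)) = setT.
    by rewrite /D (unsplitK (inr _)) (unsplitK (inl _)).
  have Dr j : D (rshift n (rshift 1 j)) = C j.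
    by rewrite /D (unsplitK (inr _)) (unsplitK (inr _)).
  have mD i : measurable (D i).
    by rewrite /D; case: fintype.split => // k; case: fintype.split.
  pose W i w := B (t i.+1) w - B (t i) w.
  have Wl (j : 'I_n) : W (lshift (1 + n) j) = X j.
    by apply/funext => w; rewrite /W /= /t ltn_ord (ltnW (ltn_ord j)).
  have Wr (j : 'I_n) : W (rshift n (rshift 1 j)) = Y j.
    apply/funext => w; rewrite /W /t.
    have -> : (rshift n (rshift 1 j) : nat) = (n.+1 + j)%N.
      by rewrite /= addnA addn1.
    rewrite leqNgt ltnS (leq_trans (leq_addr j n)) ?leqnSn//=.
    rewrite leqNgt ltnS leq_addr /= -addnS !addKn.
    by [].
  have := brownian_independent_increments hB t0 tmono mD.
  rewrite big_split_ord /= big_split_ord /= big_ord1 Dm preimage_setT.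
  rewrite probability_setT mul1e.
  have PX : P (\bigcap_(i in [set: 'I_n]) (X i @^-1` A i)) =
      (\prod_(i < n) P (X i @^-1` A i))%E.
    apply: (brownian_independent_increments hB (t := grid a L n)) => //.
    by move=> i _; rewrite -subr_ge0 grid_succ divr_ge0// ltW.
  have PY : P (\bigcap_(i in [set: 'I_n]) (Y i @^-1` C i)) =
      (\prod_(i < n) P (Y i @^-1` C i))%E.
    apply: (brownian_independent_increments hB (t := grid a' L' n)) => //.
      by rewrite grid0.
    by move=> i _; rewrite -subr_ge0 grid_succ divr_ge0// ltW.
  under eq_bigr do rewrite Dl -/(W _) Wl.
  under [X in (_ * X)%E]eq_bigr do rewrite Dr -/(W _) Wr.
  rewrite -PX -PY => <-; congr (P _); apply/seteqP; split=> w /=.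
    move=> [hX hY] i _.
    case: (splitP i) => [j ij|k ik].
      have -> : i = lshift _ j by apply/val_inj.
      by rewrite Dl; have := hX j I; rewrite -Wl.
    have -> : i = rshift _ k by apply/val_inj.
    case: (splitP k) => [j kj|j kj].
      have -> : k = lshift _ j by apply/val_inj.
      by rewrite Dm.
    have -> : k = rshift _ j by apply/val_inj.
    by rewrite Dr; have := hY j I; rewrite -Wr.
  move=> h; split=> i _.
    by have := h (lshift _ i) I; rewrite Dl -Wl.
  by have := h (rshift n (rshift 1 i)) I; rewrite Dr -Wr.
have := block_independence mX mY XY mF mF F0 F0.
under eq_integral do rewrite !FE.
by under [X in _ = (X * _)%E]eq_integral do rewrite FE;
  under [X in _ = (_ * X)%E]eq_integral do rewrite FE.
Qed.

End brownian_osc.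

(** * The oscillation of Brownian motion *)

(** The oscillation of the path is a supremum over uncountably many times of a
    path that is only almost surely continuous. The statements below therefore
    concern a measurable [Z] that is almost surely equal to this oscillation plus
    a constant [c]; in the application [Z] is the length of a slice of the tube
    and [c] is its diameter. All three pass to the limit along dyadic grids by
    monotone convergence. *)
Section brownian_osc_limits.
Context d (Omega : measurableType d) (R : realType) (P : probability Omega R).
Context (B : R -> {RV P >-> R}) (hB : standard_brownian_motion B).
Local Notation path w := (fun t => B t w).
Local Open Scope ereal_scope.

Lemma brownian_path_continuous :
  {ae P, forall w, forall a b : R, (0 <= a)%R ->
    {within `[a, b], continuous (path w)}}.
Proof.
apply: filterS (brownian_continuous hB) => w cw a b a0.
apply: continuous_subspaceW cw => x /=; rewrite !in_itv/= => /andP[ax _].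
by rewrite (le_trans a0 ax).
Qed.

Local Lemma approx_cvg a b c (w : Omega) : (0 <= a)%R -> (a < b)%R ->
  (forall a b : R, (0 <= a)%R -> {within `[a, b], continuous (path w)}) ->
  (grid_range (path w) a (b - a) m + c)%:E @[m --> \oo] -->
  (osc (path w) a b + c)%:E.
Proof.
move=> a0 ab cw; apply: cvg_EFin; first by near=> m.
apply: cvgD; last exact: cvg_cst.
rewrite -{2}(subrKC a b); apply: grid_range_cvg; first by rewrite subr_gt0.
by rewrite subrKC; exact: cw.
Unshelve. all: by end_near. Qed.

Local Lemma approx_measurable a L m c :
  measurable_fun setT (fun w => (grid_range (path w) a L m + c)%:E).
Proof.
apply/measurable_EFinP; apply: measurable_funD => //.
exact: measurable_grid_range.
Qed.

Local Lemma approx_ge0 a L m c w : (0 <= c)%R ->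
  0 <= (grid_range (path w) a L m + c)%:E.
Proof. by move=> c0; rewrite lee_fin addr_ge0// grid_range_ge0. Qed.

Lemma integral_approx_cvg a b c (Z : Omega -> \bar R) :
  (0 <= a)%R -> (a < b)%R -> (0 <= c)%R -> measurable_fun setT Z ->
  {ae P, forall w, Z w = (osc (path w) a b + c)%:E} ->
  \int[P]_w (grid_range (path w) a (b - a) m + c)%:E @[m --> \oo] -->
  \int[P]_w Z w.
Proof.
move=> a0 ab c0 mZ Zosc; apply: ae_monotone_convergence => //.
- by move=> m; exact: approx_measurable.
- by move=> m w; exact: approx_ge0.
- by move=> w m n mn; rewrite lee_fin lerD2r nondecreasing_grid_range.
- by apply: filterS2 Zosc brownian_path_continuous => w -> cw; exact: approx_cvg.
Qed.

Lemma expectation_osc a b c (Z : Omega -> \bar R) :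
  (0 <= a)%R -> (a < b)%R -> (0 <= c)%R -> measurable_fun setT Z ->
  {ae P, forall w, Z w = (osc (path w) a b + c)%:E} ->
  \int[P]_w Z w = (4 * Num.sqrt ((b - a) / (2 * pi)) + c)%:E.
Proof.
move=> a0 ab c0 mZ Zosc.
have L0 : (0 < b - a)%R by rewrite subr_gt0.
apply: (cvg_unique _ (integral_approx_cvg a0 ab c0 mZ Zosc)) => //.
have -> : (fun m => \int[P]_w (grid_range (path w) a (b - a) m + c)%:E) =
    (fun m => \int[P]_w (grid_range (path w) a (b - a) m)%:E + c%:E).
  apply/funext => m; under eq_integral do rewrite EFinD.
  rewrite ge0_integralD//.
  - by rewrite integral_cst//= probability_setT mule1.
  - by move=> w _; rewrite lee_fin grid_range_ge0.
  - by apply/measurable_EFinP; exact: measurable_grid_range.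
rewrite /= EFinD; apply: cvgeD => //; last exact: cvg_cst.
exact: expectation_grid_range_cvg.
Qed.

Lemma second_moment_osc a b c (Z : Omega -> \bar R) :
  (0 <= a)%R -> (a < b)%R -> (0 <= c)%R -> measurable_fun setT Z ->
  {ae P, forall w, Z w = (osc (path w) a b + c)%:E} ->
  \int[P]_w (Z w * Z w) <= (48 * (b - a) + 2 * c ^+ 2)%:E.
Proof.
move=> a0 ab c0 mZ Zosc.
have L0 : (0 < b - a)%R by rewrite subr_gt0.
pose g m w := (grid_range (path w) a (b - a) m + c)%:E.
have mg m : measurable_fun setT (g m) by exact: approx_measurable.
have g0 m w : 0 <= g m w by exact: approx_ge0.
have cv : \int[P]_w (g m w * g m w) @[m --> \oo] --> \int[P]_w (Z w * Z w).
  apply: ae_monotone_convergence.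
  - by move=> m; exact: emeasurable_funM.
  - by move=> m w; rewrite mule_ge0.
  - move=> w m n mn; apply: lee_pmul => //;
      by rewrite lee_fin lerD2r nondecreasing_grid_range.
  - exact: emeasurable_funM.
  - apply: filterS2 Zosc brownian_path_continuous => w -> cw.
    by apply: cvgeM; [by []|exact: approx_cvg|exact: approx_cvg].
rewrite -(cvg_lim _ cv)//; apply: lime_le; first by apply/cvg_ex; eexists; exact: cv.
near=> m.
apply: (@le_trans _ _ (\int[P]_w
    (2%:E * (grid_range (path w) a (b - a) m ^+ 2)%:E + (2 * c ^+ 2)%:E))).
  apply: ge0_le_integral => //.
  - by move=> w _; rewrite mule_ge0.
  - exact: emeasurable_funM.
  - apply: emeasurable_funD => //; apply: emeasurable_funM => //.
    apply/measurable_EFinP; apply: measurable_funX.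
    exact: measurable_grid_range.
  - move=> w _; rewrite /g -!EFinM -EFinD lee_fin.
    by have := sqr_ge0 (grid_range (path w) a (b - a) m - c); nra.
rewrite ge0_integralD//.
- rewrite ge0_integralZl//.
  + rewrite integral_cst// [X in _ + _ * X](_ : _ = 1); last first.
      exact: probability_setT.
    have -> : (48 * (b - a) = 2 * (24 * (b - a)))%R by ring.
    rewrite mule1 [leRHS]EFinD; apply: leeD => //.
    by rewrite [leRHS]EFinM lee_pmul2l// second_moment_grid_range.
  + apply/measurable_EFinP; apply: measurable_funX.
    exact: measurable_grid_range.
  + by move=> w _; rewrite lee_fin sqr_ge0.
- by move=> w _; rewrite mule_ge0// lee_fin sqr_ge0.
- apply: emeasurable_funM => //.
  apply/measurable_EFinP; apply: measurable_funX.
  exact: measurable_grid_range.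
- by move=> w _; rewrite lee_fin mulr_ge0// sqr_ge0.
Unshelve. all: by end_near. Qed.

Lemma osc_independence a b a' b' c (Z Z' : Omega -> \bar R) :
  (0 <= a)%R -> (a < b)%R -> (a' < b')%R -> (b <= a')%R -> (0 <= c)%R ->
  measurable_fun setT Z -> measurable_fun setT Z' ->
  {ae P, forall w, Z w = (osc (path w) a b + c)%:E} ->
  {ae P, forall w, Z' w = (osc (path w) a' b' + c)%:E} ->
  \int[P]_w (Z w * Z' w) = \int[P]_w Z w * \int[P]_w Z' w.
Proof.
move=> a0 ab ab' ba' c0 mZ mZ' Zosc Zosc'.
have a'0 : (0 <= a')%R by lra.
pose g m w := (grid_range (path w) a (b - a) m + c)%:E.
pose g' m w := (grid_range (path w) a' (b' - a') m + c)%:E.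
have mg m : measurable_fun setT (g m) by exact: approx_measurable.
have mg' m : measurable_fun setT (g' m) by exact: approx_measurable.
have g0 m w : 0 <= g m w by exact: approx_ge0.
have g'0 m w : 0 <= g' m w by exact: approx_ge0.
have cv : \int[P]_w (g m w * g' m w) @[m --> \oo] --> \int[P]_w (Z w * Z' w).
  apply: ae_monotone_convergence.
  - by move=> m; exact: emeasurable_funM.
  - by move=> m w; rewrite mule_ge0.
  - move=> w m n mn; apply: lee_pmul => //;
      by rewrite lee_fin lerD2r nondecreasing_grid_range.
  - exact: emeasurable_funM.
  - apply: filterS3 Zosc Zosc' brownian_path_continuous => w -> -> cw.
    by apply: cvgeM; [by []|exact: approx_cvg|exact: approx_cvg].
have cZ := integral_approx_cvg a0 ab c0 mZ Zosc.
have cZ' := integral_approx_cvg a'0 ab' c0 mZ' Zosc'.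
apply: (cvg_unique _ cv) => //.
have -> : (fun m => \int[P]_w (g m w * g' m w)) =
    (fun m => \int[P]_w g m w * \int[P]_w g' m w).
  apply/funext => m; apply: grid_range_independence => //; rewrite ?subr_gt0//.
  by rewrite subrKC.
apply: cvgeM => //.
by rewrite (expectation_osc a0 ab c0 mZ Zosc) (expectation_osc a'0 ab' c0 mZ' Zosc').
Qed.

End brownian_osc_limits.

(** * The geometry of a tube around the graph of a continuous path *)

Section tube_geometry.
Context (R : realType).
Variables (f : R -> R) (T1 T2 : R).
Hypothesis T12 : T1 <= T2.
Hypothesis cf : {within `[T1, T2], continuous f}.

Lemma graph_dist_le_at (s : R * R) t : t \in `[T1, T2] ->
  graph_dist f T1 T2 s <= Num.max `|t - s.1| `|f t - s.2|.
Proof.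
move=> tI; apply: ge_inf; last by exists t.
by exists 0 => _ [x _ <-]; rewrite le_max normr_ge0.
Qed.

(** The infimum is attained, by compactness. *)
Lemma graph_distP (s : R * R) eta : graph_dist f T1 T2 s <= eta <->
  exists t, [/\ t \in `[T1, T2], `|t - s.1| <= eta & `|f t - s.2| <= eta].
Proof.
split=> [h|[t [tI t1 t2]]]; last first.
  by apply: (le_trans (graph_dist_le_at s tI)); rewrite ge_max t1.
pose g t := Num.max `|t - s.1| `|f t - s.2|.
have cg : {within `[T1, T2], continuous g}.
  have -> : g = (fun y => (`|y - s.1| + `|f y - s.2| +
      `| `|y - s.1| - `|f y - s.2| |) / 2).
    by apply/funext => y; exact: maxr_absE.
  apply/subspace_continuousP => x xI.
  have fx := (subspace_continuousP _ _).1 cf x xI.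
  have c1 : `|t - s.1| @[t --> within `[T1, T2] (nbhs x)] --> `|x - s.1|.
    apply: cvg_norm; apply: cvgB; last exact: cvg_cst.
    by apply: cvg_within_filter; exact: cvg_id.
  have c2 : `|f t - s.2| @[t --> within `[T1, T2] (nbhs x)] --> `|f x - s.2|.
    by apply: cvg_norm; apply: cvgB; [exact: fx|exact: cvg_cst].
  apply: cvgM; last exact: cvg_cst.
  by apply: cvgD; [exact: cvgD|apply: cvg_norm; exact: cvgB].
have [t tI tmin] := EVT_min T12 cg.
have gt : g t <= graph_dist f T1 T2 s.
  apply: lb_le_inf; first by exists (g t), t.
  by move=> _ [x xI <-]; exact: tmin.
exists t; split => //; apply: le_trans h; apply: le_trans gt; rewrite /g.
  by rewrite le_max lexx.
by rewrite le_max lexx orbT.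
Qed.

(** The points of the slice lie between the extrema of the path over the time
    window, up to [eta]; conversely the intermediate value theorem provides a
    time at which the path is close enough. *)
Lemma tube_slice (u eta : R) :
  let a := Num.max T1 (u - eta) in let b := Num.min T2 (u + eta) in
  0 <= eta -> a <= b ->
  exists lo hi, [set v | graph_dist f T1 T2 (u, v) <= eta] = `[lo, hi]%classic /\
    hi - lo = osc f a b + 2 * eta.
Proof.
move=> a b e0 ab.
have abT x : x \in `[a, b] <-> x \in `[T1, T2] /\ `|x - u| <= eta.
  rewrite !in_itv/= /a /b ge_max le_min ler_norml; split.
    by move=> /andP[/andP[-> h1] /andP[-> h2]]; split => //; lra.
  by move=> [/andP[-> ->] /andP[h1 h2]] /=; apply/andP; split; lra.
have cab : {within `[a, b], continuous f}.
  by apply: continuous_subspaceW cf => x /= /abT[].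
have [s [t [sI tI ext ->]]] := osc_extrema ab cab.
exists (f t - eta), (f s + eta); split; last by ring.
apply/seteqP; split=> v /=.
  move=> /graph_distP[x /= [xT xu xv]].
  have /ext/andP[h1 h2] : x \in `[a, b] by apply/abT.
  by rewrite in_itv/=; move: xv; rewrite ler_norml => /andP[]; lra.
rewrite in_itv/= => /andP[v1 v2].
have fts : f t <= f s by case/andP: (ext s sI).
have {v1 v2} [c [c1 c2 c3]] : exists c, [/\ f t <= c, c <= f s & `|c - v| <= eta].
  case: (leP v (f t)) => [h|h1].
    by exists (f t); split => //; rewrite ler_norml; apply/andP; split; lra.
  case: (leP (f s) v) => [h|h2].
    by exists (f s); split => //; rewrite ler_norml; apply/andP; split; lra.
  by exists v; rewrite subrr normr0; split => //; exact: ltW.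
have [x xI fx] : exists2 x, x \in `[a, b] & f x = c.
  move: sI tI; rewrite !in_itv/= => /andP[as_ sb] /andP[at_ tb].
  case: (leP s t) => [st|/ltW ts].
    have cst : {within `[s, t], continuous f}.
      apply: continuous_subspaceW cab; apply: subset_itvScc => //.
    have [|x] := IVT (v := c) st cst; first by rewrite ge_min le_max c1 c2 !orbT.
    rewrite in_itv/= => /andP[sx xt] <-; exists x => //.
    by rewrite in_itv/= (le_trans as_ sx) (le_trans xt tb).
  have cts : {within `[t, s], continuous f}.
    by apply: continuous_subspaceW cab; apply: subset_itvScc.
  have [|x] := IVT (v := c) ts cts; first by rewrite ge_min le_max c1 c2 !orbT.
  rewrite in_itv/= => /andP[sx xt] <-; exists x => //.
  by rewrite in_itv/= (le_trans at_ sx) (le_trans xt sb).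
have [xT xu] := (abT x).1 xI.
by apply/graph_distP; exists x; rewrite fx.
Qed.

Lemma lebesgue_measure_tube_slice (u eta : R) :
  let a := Num.max T1 (u - eta) in let b := Num.min T2 (u + eta) in
  0 <= eta -> a <= b ->
  lebesgue_measure [set v | graph_dist f T1 T2 (u, v) <= eta] =
  (osc f a b + 2 * eta)%:E.
Proof.
move=> a b e0 ab; have [lo [hi [-> h]]] := tube_slice e0 ab.
have cab : {within `[a, b], continuous f}.
  apply: continuous_subspaceW cf; apply: subset_itvScc.
    by rewrite bnd_simp le_max lexx.
  by rewrite bnd_simp ge_min lexx.
have := osc_ge0 ab cab => o0.
rewrite lebesgue_measure_itv/= lte_fin; case: ltP => [_|hilo].
  by rewrite -EFinB h.
by congr EFin; rewrite -/a -/b in h *; lra.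
Qed.

Lemma tube_slice_empty (u eta : R) :
  ~~ (T1 - eta <= u <= T2 + eta) ->
  [set v | graph_dist f T1 T2 (u, v) <= eta] = set0.
Proof.
move=> uI; rewrite -subset0 => v /= /graph_distP[x /= [xI + _]].
move: uI xI; rewrite in_itv/= ler_norml => /negP uI /andP[x1 x2] /andP[h1 h2].
by apply: uI; apply/andP; split; lra.
Qed.

Definition clamp (x : R) : R := Num.max T1 (Num.min T2 x).

Lemma clamp_mem x : clamp x \in `[T1, T2].
Proof. by rewrite in_itv/= /clamp le_max lexx /= ge_max T12 ge_min lexx. Qed.

(** The tube as a countable intersection of countable unions of rectangles
    determined by the values of the path at fixed times: a continuous path comes
    within [eta] of a point exactly when, for every positive slack, it comes
    within [eta] plus that slack at a rational time. *)
Lemma graph_dist_rational (s : R * R) eta : T1 < T2 ->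
  graph_dist f T1 T2 s <= eta <->
  forall n : nat, exists q : rat,
    `|clamp (ratr q) - s.1| <= eta + n.+1%:R^-1 /\
    `|f (clamp (ratr q)) - s.2| <= eta + n.+1%:R^-1.
Proof.
move=> T12'; split=> [/graph_distP[t [tI t1 t2]] n|h].
  have e0 : 0 < n.+1%:R^-1 :> R by rewrite invr_gt0.
  have [r r0 hr] := within_itv_continuous_dist cf tI e0.
  set e := n.+1%:R^-1 in e0 hr *; pose r' := Num.min r e.
  have r'0 : 0 < r' by rewrite lt_min r0 e0.
  move: (tI); rewrite in_itv/= => /andP[T1t tT2].
  have : Num.max T1 (t - r') < Num.min T2 (t + r').
    by rewrite gt_max !lt_min T12'; apply/andP; split; apply/andP; split; lra.
  move=> /rat_in_itvoo[q]; rewrite in_itv/= gt_max lt_min.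
  move=> /andP[/andP[q1 q2] /andP[q3 q4]]; exists q.
  have -> : clamp (ratr q) = ratr q.
    by rewrite /clamp (min_idPr (ltW q3)) (max_idPr (ltW q1)).
  have tq : `|t - ratr q| < r' by rewrite ltr_norml; apply/andP; split; lra.
  move: (tq); rewrite lt_min => /andP[tqr tqe].
  have := hr (ratr q); rewrite in_itv/= (ltW q1) (ltW q3) => /(_ isT tqr) ft.
  split.
    have -> : ratr q - s.1 = (t - s.1) - (t - ratr q) by ring.
    by apply: le_trans (ler_normB _ _) _; rewrite lerD// ltW.
  have -> : f (ratr q) - s.2 = (f t - s.2) - (f t - f (ratr q)) by ring.
  by apply: le_trans (ler_normB _ _) _; rewrite lerD.
apply/ler_addgt0Pr => e e0.
have [n ne] : exists n : nat, n.+1%:R^-1 <= e.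
  exists (Num.truncn e^-1); rewrite -[leRHS]invrK lef_pV2 ?posrE ?invr_gt0//.
  by rewrite ltW// truncnS_gt.
have [q [q1 q2]] := h n.
apply: (le_trans (graph_dist_le_at s (clamp_mem (ratr q)))).
have le_e x : x <= eta + n.+1%:R^-1 -> x <= eta + e.
  by move/le_trans; apply; rewrite lerD2l.
by rewrite ge_max !le_e.
Qed.

End tube_geometry.

(** * Joint measurability of the random tube *)

Section tube_event.
Context d (Omega : measurableType d) (R : realType) (P : probability Omega R).
Context (B : R -> {RV P >-> R}) (T1 T2 : R).
Local Notation path w := (fun t => B t w).
Local Notation mu := (@lebesgue_measure R).

(** A measurable set whose section at an outcome with a continuous path is the part
    of the tube over [D]. Its sections give at once the measurability of the
    tube, that of the length of a slice jointly in the outcome and the time, and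
    that of the area. *)
Definition tube_event (D : set R) (eta : R) :
    set ((Omega * measurableTypeR R) * measurableTypeR R) :=
  [set z | D z.1.2] `&` \bigcap_n \bigcup_(q : rat)
    [set z | `|clamp T1 T2 (ratr q) - z.1.2| <= eta + n.+1%:R^-1 /\
       `|B (clamp T1 T2 (ratr q)) z.1.1 - z.2| <= eta + n.+1%:R^-1].

(** The pair consists of an outcome and a time. *)
Definition slice_length D eta (z : Omega * measurableTypeR R) : \bar R :=
  mu (xsection (tube_event D eta) z).

Definition swept_area D eta (w : Omega) : \bar R :=
  (\int[mu]_u slice_length D eta (w, u))%E.

Definition tube_on (f : R -> R) (D : set R) eta : set (R * R) :=
  tube f T1 T2 eta `&` [set s | D s.1].

Lemma measurable_tube_event D eta : measurable D ->
  measurable (tube_event D eta).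
Proof.
move=> mD; apply: measurableI.
  have m12 : measurable_fun setT
      (fun z : (Omega * measurableTypeR R) * measurableTypeR R => z.1.2).
    exact: (measurableT_comp measurable_snd measurable_fst).
  by rewrite -[X in measurable X]setTI; exact: m12.
apply: bigcapT_measurable => n; apply: bigcupT_measurable_rat => q.
set c := clamp _ _ _; set e := eta + _.
have le_meas (g : (Omega * measurableTypeR R) * measurableTypeR R -> R) :
    measurable_fun setT g -> measurable [set z | g z <= e].
  move=> mg; have := mg measurableT `]-oo, e]%classic (measurable_itv _).
  by rewrite setTI (_ : _ @^-1` _ = [set z | g z <= e]).
apply: (@measurableI _ _ [set z | `|c - z.1.2| <= e]
  [set z | `|B c z.1.1 - z.2| <= e]);
  apply: le_meas; apply: measurableT_comp => //.
  apply: measurable_funB => //.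
  exact: (measurableT_comp measurable_snd measurable_fst).
apply: measurable_funB; last exact: measurable_snd.
apply: (measurableT_comp (measurable_funPT (B c))).
exact: (measurableT_comp measurable_fst measurable_fst).
Qed.

Lemma slice_length_ge0 D eta z : (0 <= slice_length D eta z)%E.
Proof. exact: measure_ge0. Qed.

Lemma measurable_slice_length D eta : measurable D ->
  measurable_fun setT (slice_length D eta).
Proof.
by move=> mD; exact: (measurable_fun_xsection mu (measurable_tube_event eta mD)).
Qed.

Lemma measurable_swept_area D eta : measurable D ->
  measurable_fun setT (swept_area D eta).
Proof.
move=> mD; apply: (measurable_fun_fubini_tonelli_F (m2 := mu)).
  exact: measurable_slice_length.
by move=> z; exact: slice_length_ge0.
Qed.

Lemma measurable_slice_length_at D eta u : measurable D ->
  measurable_fun setT (fun w => slice_length D eta (w, u)).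
Proof.
by move=> mD; apply: measurable_fun_pair1; exact: measurable_slice_length.
Qed.

Section continuous_path.
Hypothesis (T12 : T1 < T2).
Variable (w : Omega).
Hypothesis cw : {within `[T1, T2], continuous (path w)}.

Lemma tube_eventE D eta u v :
  tube_event D eta ((w, u), v) <->
  D u /\ graph_dist (path w) T1 T2 (u, v) <= eta.
Proof.
split=> -[Du h]; split => //.
  apply/(graph_dist_rational (ltW T12) cw _ _ T12) => n.
  by have [q _ ?] := h n I; exists q.
move=> n _.
have [q ?] := (graph_dist_rational (ltW T12) cw _ _ T12).1 h n.
by exists q.
Qed.

Lemma measurable_tube_on D eta : measurable D ->
  measurable (tube_on (path w) D eta).
Proof.
move=> mD; pose g (s : R * R) : (Omega * measurableTypeR R) * measurableTypeR R :=
  ((w, s.1), s.2).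
have -> : tube_on (path w) D eta = g @^-1` tube_event D eta.
  apply/seteqP; split=> -[u v] /=.
    by move=> [h1 h2]; apply/tube_eventE.
  by move=> /tube_eventE[h1 h2].
have mg : measurable_fun setT g.
  apply: measurable_fun_pair; last exact: measurable_snd.
  by apply: measurable_fun_pair => //; exact: measurable_fst.
by rewrite -[X in measurable X]setTI; exact: (mg measurableT _ (measurable_tube_event _ mD)).
Qed.

(** Cavalieri's principle, built into the definition of the product measure. *)
Lemma lebesgue_measure2_tube_on D eta :
  lebesgue_measure2 (tube_on (path w) D eta) = swept_area D eta w.
Proof.
rewrite /lebesgue_measure2 /product_measure1 /swept_area.
apply: eq_integral => u _; rewrite /slice_length /=; congr (mu _).
apply/seteqP; split=> v; rewrite /xsection /= !inE.
  by move=> [h1 h2]; apply/tube_eventE.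
by move=> /tube_eventE[h1 h2].
Qed.

Lemma slice_length_in D eta u : 0 <= eta -> D u ->
  D `<=` `[T1 - eta, T2 + eta] ->
  slice_length D eta (w, u) =
  (osc (path w) (Num.max T1 (u - eta)) (Num.min T2 (u + eta)) + 2 * eta)%:E.
Proof.
move=> e0 Du Dsub; rewrite -lebesgue_measure_tube_slice//; last 2 first.
- exact: ltW.
- have := Dsub _ Du; rewrite /= in_itv/= => /andP[u1 u2].
  by rewrite ge_max !le_min (ltW T12) /=; lra.
rewrite /slice_length; congr (mu _); apply/seteqP.
split=> v; rewrite /xsection /= ?inE.
  by move=> /tube_eventE[].
by move=> h; apply/tube_eventE.
Qed.

End continuous_path.

Lemma slice_length_out D eta w u : ~ D u -> slice_length D eta (w, u) = 0%E.
Proof.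
move=> Du; rewrite /slice_length [X in mu X](_ : _ = set0) ?measure0//.
by rewrite -subset0 => v; rewrite /xsection /= inE => -[].
Qed.

End tube_event.

(** * Moments of the length of a slice of the tube *)

Lemma osc_point (R : realType) (f : R -> R) a : osc f a a = 0.
Proof. by rewrite /osc set_itv1 image_set1 sup1 inf1 subrr. Qed.

Lemma lee_mul_sqrD (R : realType) (x y : \bar R) : (0 <= x)%E -> (0 <= y)%E ->
  (x * y <= x * x + y * y)%E.
Proof.
move=> x0 y0; have [xy|/ltW yx] := leP x y.
  apply: (@le_trans _ _ (y * y)%E); first exact: lee_wpmul2r.
  by rewrite leeDr// mule_ge0.
apply: (@le_trans _ _ (x * x)%E); first exact: lee_wpmul2l.
by rewrite leeDl// mule_ge0.
Qed.

Section slices.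
Context d (Omega : measurableType d) (R : realType) (P : probability Omega R).
Context (B : R -> {RV P >-> R}) (hB : standard_brownian_motion B).
Context (T1 T2 : R) (hT1 : 0 <= T1) (T12 : T1 < T2).
Context (D : set R) (mD : measurable D) (eta : R) (eta0 : 0 < eta).
Hypothesis DT : D `<=` `[T1 - eta, T2 + eta].
Local Notation path w := (fun t => B t w).
Local Notation mu := (@lebesgue_measure R).
Local Notation sl := (slice_length B T1 T2 D eta).
Local Notation lo u := (Num.max T1 (u - eta)).
Local Notation hi u := (Num.min T2 (u + eta)).

Definition window_length (u : R) : R := hi u - lo u.

Definition mean_slice (u : R) : R :=
  4 * Num.sqrt (window_length u / (2 * pi)) + 2 * eta.

(* bounds the second moment of a slice: its window has length at most 2 eta, and
   96 = 48 * 2 *)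
Let K : R := 96 * eta + 8 * eta ^+ 2.

Local Lemma lo_ge0 u : 0 <= lo u. Proof. by rewrite le_max hT1. Qed.

Local Lemma lo_le_hi u : D u -> lo u <= hi u.
Proof.
move=> /DT /=; rewrite in_itv/= => /andP[u1 u2].
by rewrite ge_max !le_min (ltW T12) /=; have := eta0; lra.
Qed.

Lemma window_length_le u : window_length u <= 2 * eta.
Proof.
rewrite /window_length lerBlDr.
have h1 : hi u <= u + eta by rewrite ge_min lexx orbT.
have h2 : u - eta <= lo u by rewrite le_max lexx orbT.
by lra.
Qed.

Lemma ae_slice_length u : D u ->
  {ae P, forall w, sl (w, u) = (osc (path w) (lo u) (hi u) + 2 * eta)%:E}.
Proof.
move=> Du; apply: filterS (brownian_path_continuous hB) => w cw.
by apply: slice_length_in => //; [exact: cw|exact: ltW].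
Qed.

Local Lemma ae_slice_length_degenerate u : D u -> lo u = hi u ->
  {ae P, forall w, sl (w, u) = (2 * eta)%:E}.
Proof.
move=> Du lohi; apply: filterS (ae_slice_length Du) => w ->.
by rewrite -lohi osc_point add0r.
Qed.

Local Lemma msl u : measurable_fun setT (fun w => sl (w, u)).
Proof. exact: measurable_slice_length_at. Qed.

Local Lemma sl0 z : (0 <= sl z)%E. Proof. exact: slice_length_ge0. Qed.

Local Lemma eta2_ge0 : 0 <= 2 * eta. Proof. by rewrite mulr_ge0// ltW. Qed.

(** At the two extreme times the window is reduced to a point and the slice has
    length 2 eta, in agreement with the general formula. *)
Lemma expectation_slice u : D u ->
  (\int[P]_w sl (w, u) = (mean_slice u)%:E)%E.
Proof.
move=> Du; have := lo_le_hi Du; rewrite le_eqVlt => /orP[/eqP lohi|lohi].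
  rewrite (ae_eq_integral (cst (2 * eta)%:E))//=; last 2 first.
  - exact: msl.
  - by apply: filterS (ae_slice_length_degenerate Du lohi) => w ->.
  rewrite integral_cst//= probability_setT mule1 /mean_slice /window_length.
  by rewrite lohi subrr mul0r sqrtr0 mulr0 add0r.
exact: (expectation_osc hB (lo_ge0 u) lohi eta2_ge0 (msl u) (ae_slice_length Du)).
Qed.

Lemma second_moment_slice u : (\int[P]_w (sl (w, u) * sl (w, u)) <= K%:E)%E.
Proof.
have K0 : 0 <= K.
  by rewrite /K addr_ge0// mulr_ge0// ?sqr_ge0// ltW.
have [Du|Du] := pselect (D u); last first.
  rewrite integral0_eq ?lee_fin// => w _.
  by rewrite slice_length_out// mule0.
have := lo_le_hi Du; rewrite le_eqVlt => /orP[/eqP lohi|lohi].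
  rewrite (ae_eq_integral (cst ((2 * eta) * (2 * eta))%:E))//=; last 2 first.
  - by apply: emeasurable_funM; exact: msl.
  - by apply: filterS (ae_slice_length_degenerate Du lohi) => w ->.
  rewrite integral_cst//= probability_setT mule1 lee_fin /K.
  by have := sqr_ge0 eta; have := eta0; nra.
apply: le_trans (second_moment_osc hB (lo_ge0 u) lohi eta2_ge0 (msl u)
  (ae_slice_length Du)) _.
rewrite lee_fin /K; have := window_length_le u; rewrite /window_length.
by have := eta0; nra.
Qed.

Local Lemma slice_independence_lt u v : D u -> D v -> u + 2 * eta <= v ->
  (\int[P]_w (sl (w, u) * sl (w, v)) =
   \int[P]_w sl (w, u) * \int[P]_w sl (w, v))%E.
Proof.
move=> Du Dv uv.
have hl : hi u <= lo v.
  rewrite le_max ge_min; apply/orP; right; rewrite ge_min.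
  by apply/orP; right; lra.
have := lo_le_hi Du; rewrite le_eqVlt => /orP[/eqP lohi|lohi].
  rewrite (ae_eq_integral (fun w => (2 * eta)%:E * sl (w, v))%E)//; last 3 first.
  - by apply: emeasurable_funM; exact: msl.
  - by apply: emeasurable_funM => //; exact: msl.
  - by apply: filterS (ae_slice_length_degenerate Du lohi) => w ->.
  rewrite [in RHS](ae_eq_integral (cst (2 * eta)%:E))//=; last 2 first.
  - exact: msl.
  - by apply: filterS (ae_slice_length_degenerate Du lohi) => w ->.
  rewrite integral_cst//= probability_setT mule1 ge0_integralZl//.
  - exact: msl.
  - by rewrite lee_fin eta2_ge0.
have := lo_le_hi Dv; rewrite le_eqVlt => /orP[/eqP lohi'|lohi'].
  rewrite (ae_eq_integral (fun w => sl (w, u) * (2 * eta)%:E)%E)//; last 3 first.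
  - by apply: emeasurable_funM; exact: msl.
  - by apply: emeasurable_funM => //; exact: msl.
  - by apply: filterS (ae_slice_length_degenerate Dv lohi') => w ->.
  rewrite [X in _ = (_ * X)%E](ae_eq_integral (cst (2 * eta)%:E))//=; last 2 first.
  - exact: msl.
  - by apply: filterS (ae_slice_length_degenerate Dv lohi') => w ->.
  rewrite integral_cst//= probability_setT mule1 ge0_integralZr//.
  - exact: msl.
  - by rewrite lee_fin eta2_ge0.
exact: (osc_independence hB (lo_ge0 u) lohi lohi' hl eta2_ge0 (msl u) (msl v)
  (ae_slice_length Du) (ae_slice_length Dv)).
Qed.

(** Slices at distance at least 2 eta depend on the path over intervals that do not
    overlap, hence are uncorrelated; nearby slices are controlled by their second
    moments. *)
Lemma slice_correlation u v :
  (\int[P]_w (sl (w, u) * sl (w, v)) <=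
   \int[P]_w sl (w, u) * \int[P]_w sl (w, v) +
   (2 * K * \1_D u * \1_(ball u (2 * eta)) v)%:E)%E.
Proof.
have K0 : 0 <= K.
  by rewrite /K addr_ge0// mulr_ge0// ?sqr_ge0// ltW.
have I0 x : (0 <= \int[P]_w sl (w, x))%E by apply: integral_ge0 => w _; exact: sl0.
have rhs0 : (0 <= \int[P]_w sl (w, u) * \int[P]_w sl (w, v) +
   (2 * K * \1_D u * \1_(ball u (2 * eta)) v)%:E)%E.
  by rewrite adde_ge0 ?mule_ge0// lee_fin !mulr_ge0.
have [Du|Du] := pselect (D u); last first.
  by rewrite integral0_eq// => w _; rewrite slice_length_out// mul0e.
have [Dv|Dv] := pselect (D v); last first.
  by rewrite integral0_eq// => w _; rewrite (slice_length_out _ _ _ _ _ Dv)// mule0.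
have [uv|uv] := pselect (ball u (2 * eta) v).
  rewrite !indicE !mem_set// !mulr1.
  apply: (@le_trans _ _ (2 * K)%:E); last by rewrite leeDr// mule_ge0.
  apply: (@le_trans _ _ (\int[P]_w (sl (w, u) * sl (w, u) + sl (w, v) * sl (w, v)))%E).
    apply: ge0_le_integral => //.
    - by move=> w _; rewrite mule_ge0// sl0.
    - by apply: emeasurable_funM; exact: msl.
    - by apply: emeasurable_funD; apply: emeasurable_funM; exact: msl.
    - by move=> w _; apply: lee_mul_sqrD; exact: sl0.
  rewrite ge0_integralD//; last 4 first.
  - by move=> w _; rewrite mule_ge0// sl0.
  - by apply: emeasurable_funM; exact: msl.
  - by move=> w _; rewrite mule_ge0// sl0.
  - by apply: emeasurable_funM; exact: msl.
  have -> : (2 * K)%:E = (K%:E + K%:E)%E by rewrite -EFinD; congr EFin; ring.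
  by apply: leeD; exact: second_moment_slice.
rewrite [X in (_ <= _ + X)%E](_ : _ = 0%E) ?adde0; last first.
  by rewrite !indicE [v \in _]memNset// mulr0.
have : (u + 2 * eta <= v) || (v + 2 * eta <= u).
  apply/negPn; rewrite negb_or -!ltNge; apply/negP => /andP[h1 h2].
  by apply: uv; rewrite /ball /= ltr_norml; apply/andP; split; lra.
case/orP => h; first by rewrite slice_independence_lt.
under eq_integral do rewrite muleC.
by rewrite slice_independence_lt// muleC.
Qed.

End slices.

(** * Moments of the area of the tube *)

Lemma osc_le (R : realType) (f : R -> R) a b c d : a <= b ->
  {within `[c, d], continuous f} -> `[a, b] `<=` `[c, d] ->
  osc f a b <= osc f c d.
Proof.
move=> ab cf sub.
have cd : c <= d.
  have : a \in `[a, b] by rewrite in_itv/= lexx ab.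
  by move=> /sub /=; rewrite in_itv/= => /andP[]; exact: le_trans.
have [s [t [sI tI h ->]]] := osc_extrema ab (continuous_subspaceW sub cf).
have [s' [t' [sI' tI' h' ->]]] := osc_extrema cd cf.
have /andP[_ h1] := h' s (sub _ sI); have /andP[h2 _] := h' t (sub _ tI).
by lra.
Qed.

Section swept.
Context d (Omega : measurableType d) (R : realType) (P : probability Omega R).
Context (B : R -> {RV P >-> R}) (hB : standard_brownian_motion B).
Context (T1 T2 : R) (hT1 : 0 <= T1) (T12 : T1 < T2).
Context (D : set R) (mD : measurable D) (eta : R) (eta0 : 0 < eta).
Hypothesis DT : D `<=` `[T1 - eta, T2 + eta].
Local Notation path w := (fun t => B t w).
Local Notation mu := (@lebesgue_measure R).
Local Notation sl := (slice_length B T1 T2 D eta).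
Local Notation sw := (swept_area B T1 T2 D eta).
Local Open Scope ereal_scope.

Lemma swept_area_ge0 w : 0 <= sw w.
Proof. by apply: integral_ge0 => u _; exact: slice_length_ge0. Qed.

Lemma expectation_swept_area :
  \int[P]_w sw w = \int[mu]_(u in D) (mean_slice T1 T2 eta u)%:E.
Proof.
rewrite /swept_area (fubini_tonelli (m1 := P) (m2 := mu) sl); last 2 first.
- exact: measurable_slice_length.
- by move=> z; exact: slice_length_ge0.
rewrite [RHS]integral_mkcond; apply: eq_integral => u _.
rewrite patchE; case: ifPn => [/set_mem Du|/negP Du].
  exact: expectation_slice.
apply: integral0_eq => w _; rewrite slice_length_out// => Du'.
by apply: Du; exact/mem_set.
Qed.

(** By Tonelli's theorem the second moment is the double integral of the correlations
    of slices, and only pairs of times at distance less than 2 eta exceed the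
    product of the means. *)
Lemma second_moment_swept_area :
  \int[P]_w (sw w * sw w) <=
  (\int[P]_w sw w) * (\int[P]_w sw w) +
  (8 * eta * (96 * eta + 8 * eta ^+ 2))%:E * mu D.
Proof.
set K := (96 * eta + 8 * eta ^+ 2)%R.
have K0 : (0 <= K)%R.
  by rewrite /K addr_ge0// mulr_ge0// ?sqr_ge0// ltW.
have e0 : (0 <= eta)%R by exact: ltW.
have msl : measurable_fun setT sl by exact: measurable_slice_length.
have msl1 u : measurable_fun setT (fun w => sl (w, u)).
  exact: measurable_slice_length_at.
have msl2 w : measurable_fun setT (fun u => sl (w, u)).
  exact: measurable_fun_pair2.
have msw : measurable_fun setT sw by exact: measurable_swept_area.
have sl0 z : 0 <= sl z by exact: slice_length_ge0.
have sw0 w : 0 <= sw w by exact: swept_area_ge0.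
pose m u := \int[P]_w sl (w, u).
have m0 u : 0 <= m u by apply: integral_ge0.
have mm : measurable_fun setT m.
  exact: (measurable_fun_fubini_tonelli_G (m1 := P) sl).
have swm : \int[P]_w sw w = \int[mu]_u m u.
  by rewrite /swept_area (fubini_tonelli (m1 := P) (m2 := mu) sl).
have mind (C : set R) : measurable C ->
    measurable_fun setT (fun u => (\1_C u : R)%:E).
  by move=> mC; apply/measurable_EFinP; exact: measurable_indic.
(* for a fixed slice, correlate it with the whole area *)
have step u : \int[P]_w (sl (w, u) * sw w) <=
    m u * \int[mu]_v m v + (8 * eta * K)%:E * (\1_D u)%:E.
  pose g z := sl (z.1, u) * sl z.
  have mg : measurable_fun setT g.
    apply: emeasurable_funM => //.
    exact: (measurableT_comp (msl1 u) measurable_fst).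
  have g0 z : 0 <= g z by rewrite mule_ge0.
  have -> : \int[P]_w (sl (w, u) * sw w) = \int[mu]_v \int[P]_w g (w, v).
    rewrite -(fubini_tonelli (m1 := P) (m2 := mu) g)//.
    apply: eq_integral => w _; rewrite /g /swept_area /= ge0_integralZl//.
  apply: (@le_trans _ _ (\int[mu]_v (m u * m v +
      (2 * K * \1_D u)%:E * (\1_(ball u (2 * eta)) v)%:E))).
    apply: ge0_le_integral => //.
    - by move=> v _; apply: integral_ge0.
    - exact: (measurable_fun_fubini_tonelli_G (m1 := P) g).
    - apply: emeasurable_funD; apply: emeasurable_funM => //.
      by apply: mind; exact: measurable_ball.
    - by move=> v _; rewrite -EFinM; exact: slice_correlation.
  rewrite ge0_integralD//; last 4 first.
  - by move=> v _; rewrite mule_ge0.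
  - exact: emeasurable_funM.
  - by move=> v _; rewrite mule_ge0// lee_fin !mulr_ge0.
  - by apply: emeasurable_funM => //; apply: mind; exact: measurable_ball.
  rewrite !ge0_integralZl//; try (by rewrite lee_fin !mulr_ge0);
    try (by apply: mind; exact: measurable_ball).
  rewrite integral_indic//; last exact: measurable_ball.
  rewrite setIT [X in _ + _ * X <= _](_ : _ = (2 * eta *+ 2)%:E); last first.
    by have := @lebesgue_measure_ball R u (2 * eta); apply; rewrite mulr_ge0.
  by rewrite leeD2l// -!EFinM lee_fin; lra.
have -> : \int[P]_w (sw w * sw w) = \int[mu]_u \int[P]_w (sl (w, u) * sw w).
  pose g z := sl z * sw z.1.
  rewrite -(fubini_tonelli (m1 := P) (m2 := mu) g)//.
  - apply: eq_integral => w _; rewrite /g /= ge0_integralZr//.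
  - apply: emeasurable_funM => //.
    exact: (measurableT_comp msw measurable_fst).
  - by move=> z; rewrite mule_ge0.
apply: (@le_trans _ _ (\int[mu]_u
    (m u * \int[mu]_v m v + (8 * eta * K)%:E * (\1_D u)%:E))).
  apply: ge0_le_integral => //.
  - by move=> u _; apply: integral_ge0 => w _; rewrite mule_ge0.
  - apply: (measurable_fun_fubini_tonelli_G (m1 := P) (fun z => sl z * sw z.1)).
      apply: emeasurable_funM => //.
      exact: (measurableT_comp msw measurable_fst).
    by move=> z; rewrite mule_ge0.
  - by apply: emeasurable_funD; apply: emeasurable_funM => //; exact: mind.
have M0 : 0 <= \int[mu]_v m v by exact: integral_ge0.
rewrite ge0_integralD//; last 4 first.
- by move=> v _; rewrite mule_ge0.
- exact: emeasurable_funM.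
- by move=> v _; rewrite mule_ge0// lee_fin !mulr_ge0.
- by apply: emeasurable_funM => //; exact: mind.
rewrite ge0_integralZr// ge0_integralZl//; last 2 first.
- exact: mind.
- by rewrite lee_fin !mulr_ge0.
by rewrite integral_indic// setIT swm.
Qed.

Lemma swept_area_fin_num w : {within `[T1, T2], continuous (path w)} ->
  mu D < +oo -> sw w \is a fin_num.
Proof.
move=> cw Dfin; rewrite ge0_fin_numE; last exact: swept_area_ge0.
pose C := (osc (path w) T1 T2 + 2 * eta)%R.
have C0 : (0 <= C)%R.
  by rewrite addr_ge0// ?mulr_ge0 ?(ltW eta0)//; apply: osc_ge0 => //; exact: ltW.
apply: (@le_lt_trans _ _ (\int[mu]_u (C%:E * (\1_D u)%:E))); last first.
  rewrite ge0_integralZl//.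
  - by rewrite integral_indic// setIT lte_mul_pinfty.
  - by apply/measurable_EFinP; exact: measurable_indic.
apply: ge0_le_integral => //.
- by apply: measurable_fun_pair2; exact: measurable_slice_length.
- by apply: emeasurable_funM => //; apply/measurable_EFinP; exact: measurable_indic.
move=> u _; have [Du|Du] := pselect (D u); last first.
  by rewrite slice_length_out// indicE memNset// mule0.
rewrite indicE mem_set// mule1 (slice_length_in T12 cw (ltW eta0) Du DT).
rewrite lee_fin lerD2r; apply: osc_le => //.
  have := DT Du; rewrite /= in_itv/= => /andP[u1 u2].
  by rewrite ge_max !le_min (ltW T12) /=; have := eta0; lra.
by apply: subset_itvScc; rewrite bnd_simp ?le_max ?ge_min lexx.
Qed.

End swept.

(** * The expected area *)

Section sqrt_integrals.
Context (R : realType).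
Local Notation mu := (@lebesgue_measure R).

(** The sign [e] treats growing and shrinking windows together. *)
Lemma integral_sqrt_affine (e c a b : R) : e * e = 1 -> a < b ->
  0 <= e * (a - c) -> 0 <= e * (b - c) ->
  (\int[mu]_(x in `[a, b]) (Num.sqrt (e * (x - c)))%:E =
   (2 / 3 * e * (e * (b - c) * Num.sqrt (e * (b - c)) -
                 e * (a - c) * Num.sqrt (e * (a - c))))%:E)%E.
Proof.
move=> ee ab a0 b0.
pose y (x : R) := e * (x - c).
pose F (x : R) := 2 / 3 * e * (y x * Num.sqrt (y x)).
have cy : continuous y.
  by move=> x; apply: cvgM; [exact: cvg_cst|apply: cvgB; [exact: cvg_id|exact: cvg_cst]].
have csq : continuous (fun x => Num.sqrt (y x)).
  by move=> x; apply: continuous_comp; [exact: cy|exact: sqrt_continuous].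
have cF : continuous F.
  move=> x; apply: cvgM; first exact: cvg_cst.
  by apply: cvgM; [exact: cy|exact: csq].
have ypos x : x \in `]a, b[ -> 0 < y x.
  rewrite in_itv/= => /andP[ax xb].
  have e1 : e = 1 \/ e = -1.
    have : (e - 1) * (e + 1) = 0 by rewrite mulrBl mulrDr ee; ring.
    by move=> /eqP; rewrite mulf_eq0 => /orP[/eqP|/eqP] ?; [left|right]; lra.
  by rewrite /y; case: e1 => e1; rewrite e1 in a0 b0 *; lra.
have dF x : x \in `]a, b[ -> is_derive x 1 F (Num.sqrt (y x)).
  move=> xab; have y0 := ypos x xab.
  have dy : is_derive x 1 y e.
    by rewrite /y; apply: is_derive_eq; rewrite /GRing.scale /=; ring.
  have ds : is_derive x 1 (fun x => Num.sqrt (y x)) ((2 * Num.sqrt (y x))^-1 * e).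
    have d1 := is_derive1_sqrt y0.
    exact: (@is_derive1_comp _ (@Num.sqrt R) y x _ _ d1 dy).
  rewrite /F; apply: is_derive_eq.
  have s0 : Num.sqrt (y x) != 0 by rewrite gt_eqF// sqrtr_gt0.
  have yE : y x = Num.sqrt (y x) * Num.sqrt (y x) by rewrite -expr2 sqr_sqrtr// ltW.
  rewrite /GRing.scale /=; set s := Num.sqrt (y x) in s0 yE *.
  by transitivity (e * e * s); [rewrite yE; field|rewrite ee mul1r].
rewrite (@continuous_FTC2 _ _ F).
- by rewrite -EFinB; congr EFin; rewrite /F /y; ring.
- exact: ab.
- exact: continuous_subspaceT.
- split.
  + by move=> x xab; case: (dF x xab).
  + by apply: cvg_at_right_filter; exact: cF.
  + by apply: cvg_at_left_filter; exact: cF.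
- move=> x xab; have := dF x xab; rewrite derive1E => dFx; exact: derive_val.
Qed.

Lemma ge0_integral_itv_split (f : R -> \bar R) (a p b : R) : a <= p -> p <= b ->
  measurable_fun setT f -> (forall x, a <= x -> x <= b -> (0 <= f x)%E) ->
  (\int[mu]_(x in `[a, b]) f x =
   \int[mu]_(x in `[a, p]) f x + \int[mu]_(x in `[p, b]) f x)%E.
Proof.
move=> ap pb mf f0.
have -> : `[a, b]%classic = `[a, p]%classic `|` `]p, b]%classic.
  by rewrite -itv_bndbnd_setU// bnd_simp.
rewrite ge0_integral_setU//=.
- by rewrite integral_itv_obnd_cbnd//; exact: measurable_funTS.
- exact: measurable_funTS.
- move=> x /=; rewrite !in_itv/= => -[|] /andP[h1 h2]; apply: f0 => //.
    exact: le_trans h2 pb.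
  by apply: ltW; exact: le_lt_trans ap h1.
- apply/disj_setPS => x [/=]; rewrite !in_itv/= => /andP[_ h1] /andP[h2 _].
  by move: (lt_le_trans h2 h1); rewrite ltxx.
Qed.

End sqrt_integrals.

Section mean_area.
Context (R : realType) (T1 T2 eta : R).
Hypothesis (eta0 : 0 < eta) (etaT : eta < (T2 - T1) / 2).
Local Notation mu := (@lebesgue_measure R).
Local Notation mean := (mean_slice T1 T2 eta).
(* 4 / sqrt (2 pi) *)
Local Notation c := (2 * Num.sqrt 2 / Num.sqrt pi : R).

Local Lemma meanE u :
  mean u = c * Num.sqrt (window_length T1 T2 eta u) + 2 * eta.
Proof.
have pi0 := pi_gt0 R; rewrite /mean_slice; congr (_ + _).
have [L0|L0] := leP (window_length T1 T2 eta u) 0.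
  rewrite (ler0_sqrtr L0) (@ler0_sqrtr _ (_ / _)) ?mulr0//.
  by rewrite mulr_le0_ge0// invr_ge0 mulr_ge0// ltW.
rewrite sqrtrM ?(ltW L0)// sqrtrV ?mulr_ge0// ?(ltW pi0)// sqrtrM//.
have q0 : Num.sqrt 2 != 0 :> R by rewrite gt_eqF// sqrtr_gt0.
have p0 : Num.sqrt pi != 0 :> R by rewrite gt_eqF// sqrtr_gt0.
have qq : (4 : R) = 2 * (Num.sqrt 2 * Num.sqrt 2).
  by rewrite -expr2 sqr_sqrtr//; ring.
by rewrite qq; field; rewrite q0 p0.
Qed.

Local Lemma measurable_mean : measurable_fun setT (fun u => (mean u)%:E).
Proof.
apply/measurable_EFinP; rewrite /mean_slice /window_length.
apply: measurable_funD => //; apply: measurable_funM => //.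
apply: (measurableT_comp (f := @Num.sqrt R)).
  by apply: continuous_measurable_fun; exact: sqrt_continuous.
apply: measurable_funM => //; apply: measurable_funB.
  by apply: measurable_minr => //; exact: measurable_funD.
by apply: measurable_maxr => //; exact: measurable_funB.
Qed.

Local Lemma mean_ge0 u : (0 <= (mean u)%:E)%E.
Proof.
by rewrite lee_fin addr_ge0 ?mulr_ge0 ?sqrtr_ge0// ltW.
Qed.

Local Lemma integral_mean_affine (e k a b : R) : e * e = 1 -> a < b ->
  0 <= e * (a - k) -> 0 <= e * (b - k) ->
  (forall u, u \in `[a, b] -> window_length T1 T2 eta u = e * (u - k)) ->
  (\int[mu]_(u in `[a, b]) (mean u)%:E =
   (c * (2 / 3 * e * (e * (b - k) * Num.sqrt (e * (b - k)) -
                 e * (a - k) * Num.sqrt (e * (a - k)))) +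
    2 * eta * (b - a))%:E)%E.
Proof.
move=> ee ab a0 b0 we.
transitivity (\int[mu]_(u in `[a, b])
    (c%:E * (Num.sqrt (e * (u - k)))%:E + (2 * eta)%:E))%E.
  apply: eq_integral => u /set_mem uab.
  by rewrite meanE we// EFinD EFinM.
have msq : measurable_fun setT (fun u : R => (Num.sqrt (e * (u - k)))%:E).
  apply/measurable_EFinP; apply: (measurableT_comp (f := @Num.sqrt R)).
    by apply: continuous_measurable_fun; exact: sqrt_continuous.
  by apply: measurable_funM => //; exact: measurable_funB.
have c0 : 0 <= c by rewrite !mulr_ge0 ?invr_ge0 ?sqrtr_ge0.
rewrite ge0_integralD//=.
- rewrite ge0_integralZl//=.
  + rewrite integral_sqrt_affine// integral_cst//.
    rewrite [X in (_ + _ * X)%E = _](_ : _ = (b - a)%:E).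
      by rewrite -!EFinM -EFinD.
    by have := lebesgue_measure_itv `[a, b]; rewrite /= lte_fin ab -EFinB.
  + exact: measurable_funTS.
- by apply: measurable_funTS; exact: emeasurable_funM.
- by move=> u _; rewrite lee_fin mulr_ge0// ltW.
Qed.

Local Lemma integral_mean_middle :
  (\int[mu]_(u in `[(T1 + eta)%R, (T2 - eta)%R]) (mean u)%:E =
   ((c * Num.sqrt (2 * eta) + 2 * eta) * (T2 - T1 - 2 * eta))%:E)%E.
Proof.
transitivity (\int[mu]_(u in `[(T1 + eta)%R, (T2 - eta)%R])
    (c * Num.sqrt (2 * eta) + 2 * eta)%:E)%E.
  apply: eq_integral => u /set_mem /=; rewrite in_itv/= => /andP[u1 u2].
  rewrite meanE /window_length (min_idPr _); last by lra.
  by rewrite (max_idPr _); [congr (_ * Num.sqrt _ + _)%:E; ring|lra].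
rewrite integral_cst// [X in (_ * X)%E = _](_ : _ = (T2 - T1 - 2 * eta)%:E)
  ?EFinM//.
have := lebesgue_measure_itv `[(T1 + eta)%R, (T2 - eta)%R].
rewrite /= lte_fin ifT; last by have := etaT; lra.
by move=> ->; rewrite -EFinB; congr EFin; ring.
Qed.

(** Near T1 the window is cut off on the left, and its length grows with slope 1
    until it reaches 2 eta. *)
Local Lemma integral_mean_left a : T1 - eta <= a -> a <= T1 ->
  (\int[mu]_(u in `[a, (T1 + eta)%R]) (mean u)%:E =
   (c * (2 / 3 * (2 * eta * Num.sqrt (2 * eta) -
      (a - T1 + eta) * Num.sqrt (a - T1 + eta))) +
    2 * eta * (T1 + eta - a))%:E)%E.
Proof.
move=> a1 a2; rewrite (@integral_mean_affine 1 (T1 - eta)); first 1 last.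
- by rewrite mulr1.
- by have := eta0; lra.
- by lra.
- by have := eta0; lra.
- move=> u; rewrite in_itv/= => /andP[u1 u2]; rewrite /window_length.
  rewrite (min_idPr _); last by have := etaT; lra.
  by rewrite (max_idPl _); [ring|lra].
have -> : 1 * (T1 + eta - (T1 - eta)) = 2 * eta by ring.
have -> : 1 * (a - (T1 - eta)) = a - T1 + eta by ring.
by rewrite mulr1.
Qed.

Local Lemma integral_mean_right b : T2 <= b -> b <= T2 + eta ->
  (\int[mu]_(u in `[(T2 - eta)%R, b]) (mean u)%:E =
   (c * (2 / 3 * (2 * eta * Num.sqrt (2 * eta) -
      (T2 + eta - b) * Num.sqrt (T2 + eta - b))) +
    2 * eta * (b - (T2 - eta)))%:E)%E.
Proof.
move=> b1 b2; rewrite (@integral_mean_affine (-1) (T2 + eta)); first 1 last.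
- by ring.
- by have := eta0; lra.
- by have := eta0; lra.
- by lra.
- move=> u; rewrite in_itv/= => /andP[u1 u2]; rewrite /window_length.
  rewrite (min_idPl _); last by lra.
  by rewrite (max_idPr _); [ring|have := etaT; lra].
have -> : -1 * (b - (T2 + eta)) = T2 + eta - b by ring.
have -> : -1 * (T2 - eta - (T2 + eta)) = 2 * eta by ring.
by congr EFin; ring.
Qed.

Local Lemma integral_mean a b : T1 - eta <= a -> a <= T1 -> T2 <= b -> b <= T2 + eta ->
  (\int[mu]_(u in `[a, b]) (mean u)%:E =
   (c * (2 / 3 * (2 * eta * Num.sqrt (2 * eta) -
      (a - T1 + eta) * Num.sqrt (a - T1 + eta))) +
    2 * eta * (T1 + eta - a) +
    (c * Num.sqrt (2 * eta) + 2 * eta) * (T2 - T1 - 2 * eta) +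
    (c * (2 / 3 * (2 * eta * Num.sqrt (2 * eta) -
      (T2 + eta - b) * Num.sqrt (T2 + eta - b))) +
    2 * eta * (b - (T2 - eta))))%:E)%E.
Proof.
move=> a1 a2 b1 b2; have := etaT => etaT'; have := eta0 => eta0'.
rewrite (@ge0_integral_itv_split _ _ a (T2 - eta) b); last 4 first.
- by lra.
- by lra.
- exact: measurable_mean.
- by move=> u _ _; exact: mean_ge0.
rewrite (@ge0_integral_itv_split _ _ a (T1 + eta) (T2 - eta)); last 4 first.
- by lra.
- by lra.
- exact: measurable_mean.
- by move=> u _ _; exact: mean_ge0.
by rewrite integral_mean_left// integral_mean_middle integral_mean_right// -!EFinD.
Qed.

Lemma powR32 (x : R) : 0 < x -> x `^ (3 / 2) = x * Num.sqrt x.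
Proof.
move=> x0; have -> : (3 / 2 : R) = 1 + 2^-1 by lra.
by rewrite powRD ?powRr1 ?powR12_sqrt ?(ltW x0)// gt_eqF ?x0 ?implybT.
Qed.

Definition mean_area : R :=
  4 / Num.sqrt pi * (T2 - T1) * Num.sqrt eta + 2 * (T2 - T1) * eta
  - 8 * (Num.sqrt 2 - 1) / (3 * Num.sqrt pi) * eta `^ (3 / 2).

(** The contribution of the times outside [[T1, T2]]. *)
Definition mean_area_caps : R :=
  8 * Num.sqrt 2 / (3 * Num.sqrt pi) * eta `^ (3 / 2) + 4 * eta ^+ 2.

Lemma integral_mean_between :
  (\int[mu]_(u in `[T1, T2]) (mean u)%:E = mean_area%:E)%E.
Proof.
have pi0 := pi_gt0 R; have := eta0 => eta0'.
rewrite integral_mean; [|by lra ..].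
congr EFin; rewrite /mean_area powR32//.
have -> : T1 - T1 + eta = eta by ring.
have -> : T2 + eta - T2 = eta by ring.
rewrite (sqrtrM eta)//.
have p0 : Num.sqrt pi != 0 :> R by rewrite gt_eqF// sqrtr_gt0.
have qq : Num.sqrt 2 * Num.sqrt 2 = 2 :> R by rewrite -expr2 sqr_sqrtr.
set q := Num.sqrt 2 in qq *; set s := Num.sqrt eta; set p := Num.sqrt pi in p0 *.
apply/eqP; rewrite -subr_eq0; apply/eqP.
transitivity ((q * q - 2) * (s / p * (16 / 3 * eta + 2 * (T2 - T1 - 2 * eta)))).
  by field.
by rewrite qq subrr mul0r.
Qed.

Lemma integral_mean_full :
  (\int[mu]_(u in `[(T1 - eta)%R, (T2 + eta)%R]) (mean u)%:E =
   (mean_area + mean_area_caps)%:E)%E.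
Proof.
have pi0 := pi_gt0 R; have := eta0 => eta0'.
rewrite integral_mean; [|by lra ..].
congr EFin; rewrite /mean_area /mean_area_caps powR32//.
have -> : T1 - eta - T1 + eta = 0 by ring.
have -> : T2 + eta - (T2 + eta) = 0 by ring.
rewrite (sqrtrM eta)// !mul0r !subr0.
have p0 : Num.sqrt pi != 0 :> R by rewrite gt_eqF// sqrtr_gt0.
have qq : Num.sqrt 2 * Num.sqrt 2 = 2 :> R by rewrite -expr2 sqr_sqrtr.
set q := Num.sqrt 2 in qq *; set s := Num.sqrt eta; set p := Num.sqrt pi in p0 *.
apply/eqP; rewrite -subr_eq0; apply/eqP.
transitivity ((q * q - 2) * (s / p * (16 / 3 * eta + 2 * (T2 - T1 - 2 * eta)))).
  by field.
by rewrite qq subrr mul0r.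
Qed.

End mean_area.

(** * Almost sure convergence from a variance bound *)

Section radii.
Context (R : realType).

(** Radii whose sum is finite and whose consecutive ratios tend to 1. *)
Definition inv_square (n : nat) : R := (n.+1%:R ^+ 2)^-1.

Lemma inv_square_gt0 n : 0 < inv_square n.
Proof. by rewrite invr_gt0 exprn_gt0. Qed.

Lemma sqrt_inv_square n : Num.sqrt (inv_square n) = n.+1%:R^-1.
Proof. by rewrite sqrtrV ?exprn_ge0// sqrtr_sqr ger0_norm. Qed.

Lemma inv_square_cvg : inv_square n @[n --> \oo] --> (0 : R).
Proof.
have -> : inv_square = (fun n => @harmonic R n * @harmonic R n).
  by apply/funext => n; rewrite /inv_square /harmonic /= expr2 invfM.
by rewrite -[X in _ --> X](mul0r 0); apply: cvgM; exact: cvg_harmonic.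
Qed.

Lemma sum_inv_square_le n : \sum_(0 <= i < n) inv_square i <= 2.
Proof.
case: n => [|n]; first by rewrite big_geq.
apply: (@le_trans _ _ (2 - n.+1%:R^-1)); last by rewrite gerBl invr_ge0.
elim: n => [|n IH].
  by rewrite big_nat1 /inv_square expr1n invr1; lra.
rewrite big_nat_recr//=; move: IH; set S := \sum_(0 <= i < n.+1) _ => IH.
have n0 : 0 < n.+1%:R :> R by [].
have -> : 2 - n.+2%:R^-1 = 2 - n.+1%:R^-1 + (n.+1%:R * n.+2%:R)^-1 :> R.
  have bE : n.+2%:R = n.+1%:R + 1 :> R by rewrite natr1.
  have b0 : n.+2%:R != 0 :> R by [].
  have a0 : n.+1%:R != 0 :> R by [].
  move: bE b0 a0; move: (n.+2%:R : R) (n.+1%:R : R) => b a -> b0 a0.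
  by field; rewrite a0 b0.
apply: lerD => //; rewrite /inv_square lef_pV2 ?posrE ?exprn_gt0 ?mulr_gt0//.
by rewrite expr2 ler_wpM2r// ler_nat.
Qed.

(** A radius lies between two consecutive radii of the sequence, whose ratio tends
    to 1. *)
Lemma interpolate_inv_square (a : R -> R) (c eta0 : R) : 0 < eta0 ->
  (forall x, 0 < x -> x < eta0 -> 0 <= a x) ->
  (forall x y, 0 < x -> x <= y -> y < eta0 -> a x <= a y) ->
  a (inv_square n) * n.+1%:R @[n --> \oo] --> c ->
  a x / Num.sqrt x @[x --> 0^'+] --> c.
Proof.
move=> eta00 a0 amono ac.
pose r n : R := n.+2%:R / n.+1%:R.
have rE n : r n = 1 + @harmonic R n.
  rewrite /r /harmonic /= -[n.+2%:R]natr1 mulrDl divff ?pnatr_eq0//.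
  by rewrite mul1r.
have rc : r n @[n --> \oo] --> (1 : R).
  have -> : r = (fun n => 1 + @harmonic R n) by apply/funext.
  rewrite -[X in _ --> X](addr0 1); apply: cvgD; first exact: cvg_cst.
  exact: cvg_harmonic.
have r0 n : 0 < r n by rewrite divr_gt0.
have uc : a (inv_square n) * n.+1%:R * r n @[n --> \oo] --> c.
  by rewrite -[X in _ --> X](mulr1 c); exact: cvgM.
have vc : a (inv_square n.+1) * n.+2%:R / r n @[n --> \oo] --> c.
  rewrite (_ : c = c / 1); last by rewrite divr1.
  apply: cvgM.
    by move: ac; rewrite -cvg_shiftS.
  by apply: cvgV => //; exact: oner_neq0.
apply/cvgrPdist_le => e e0.
have ue := (@cvgrPdist_le _ _ _ _ _ _ _).1 uc e e0.
have ve := (@cvgrPdist_le _ _ _ _ _ _ _).1 vc e e0.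
have he : \forall n \near \oo, inv_square n < eta0.
  by apply: (cvgr_lt 0) => //; exact: inv_square_cvg.
have [N _ hN] : \forall n \near \oo, [/\
    `|c - a (inv_square n) * n.+1%:R * r n| <= e,
    `|c - a (inv_square n.+1) * n.+2%:R / r n| <= e & inv_square n < eta0].
  have [N1 _ H1] := ue; have [N2 _ H2] := ve; have [N3 _ H3] := he.
  exists (maxn N1 (maxn N2 N3)) => // n /=; rewrite !geq_max.
  by move=> /and3P[n1 n2 n3]; split; [exact: H1|exact: H2|exact: H3].
near=> x.
have x0 : 0 < x by near: x; exact: nbhs_right_gt.
have xN : x < inv_square N by near: x; apply: nbhs_right_lt; exact: inv_square_gt0.
have s0 : 0 < Num.sqrt x by rewrite sqrtr_gt0.
pose y := (Num.sqrt x)^-1; have y0 : 0 < y by rewrite invr_gt0.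
have xy : x = (y ^+ 2)^-1 by rewrite /y exprVn invrK sqr_sqrtr// ltW.
have yN : N.+1%:R < y.
  rewrite /y -[ltLHS]invrK ltf_pV2 ?posrE ?invr_gt0//.
  by rewrite -sqrt_inv_square ltr_sqrt// inv_square_gt0.
have [n [Nn ny yn]] : exists n, [/\ (N <= n)%N, n.+1%:R <= y & y < n.+2%:R].
  have ty' := truncnS_gt y.
  have ty : (Num.truncn y)%:R <= y by rewrite truncn_le ltW.
  have : (N.+1 <= Num.truncn y)%N.
    by rewrite -ltnS -(ltr_nat R); apply: lt_trans ty'.
  case: (Num.truncn y) ty ty' => [//|k] ty ty' Nk.
  by exists k.
have [h1 h2 h3] := hN n Nn.
have xn : x <= inv_square n.
  by rewrite xy /inv_square lef_pV2 ?posrE ?exprn_gt0// lerXn2r ?nnegrE// ltW.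
have nx : inv_square n.+1 <= x.
  rewrite xy /inv_square lef_pV2 ?posrE ?exprn_gt0//.
  by rewrite lerXn2r ?nnegrE// ltW.
have xe : x < eta0 := le_lt_trans xn h3.
have g1 := inv_square_gt0 n.+1.
have up : a x * y <= a (inv_square n) * n.+1%:R * r n.
  rewrite /r -mulrA (mulrC n.+1%:R) divfK ?pnatr_eq0//.
  by rewrite ler_pM ?a0 ?amono// ltW.
have lo : a (inv_square n.+1) * n.+2%:R / r n <= a x * y.
  rewrite /r invf_div -mulrA (mulrC n.+2%:R) divfK ?pnatr_eq0//.
  by rewrite ler_pM ?a0 ?amono// (le_lt_trans nx).
move: h1 h2; rewrite -/y !ler_norml => /andP[h1 h1'] /andP[h2 h2'].
by apply/andP; split; lra.
Unshelve. all: by end_near. Qed.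

End radii.

Section almost_sure.
Context d (Omega : measurableType d) (R : realType) (P : probability Omega R).
Local Notation h := (@inv_square R).

Lemma ae_cvg0_of_summable (Y : nat -> Omega -> R) (K : R) : 0 <= K ->
  (forall n, measurable_fun setT (Y n)) -> (forall n w, 0 <= Y n w) ->
  (forall n, \int[P]_w (Y n w)%:E <= (K * h n)%:E)%E ->
  {ae P, forall w, Y n w @[n --> \oo] --> (0 : R)}.
Proof.
move=> K0 mY Y0 YK.
have mYE n : measurable_fun setT (fun w => (Y n w)%:E) by exact/measurable_EFinP.
pose S w := (\sum_(0 <= n <oo) (Y n w)%:E)%E.
have S0 w : (0 <= S w)%E by apply: nneseries_ge0 => n _ _; rewrite lee_fin.
have mS : measurable_fun setT S.
  by apply: ge0_emeasurable_sum => // n w _ _; rewrite lee_fin.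
have Sfin : (\int[P]_w S w < +oo)%E.
  rewrite integral_nneseries//; last by move=> n w _; rewrite lee_fin.
  apply: (@le_lt_trans _ _ (K * 2)%:E); last exact: ltry.
  apply: lime_le.
    apply: is_cvg_nneseries => n _ _.
    by apply: integral_ge0 => w _; rewrite lee_fin.
  near=> n; apply: (@le_trans _ _ (\sum_(0 <= i < n) (K * h i)%:E)%E).
    by apply: lee_sum => i _; exact: YK.
  by rewrite sumEFin lee_fin -mulr_sumr ler_wpM2l// sum_inv_square_le.
have /(integrable_ae measurableT) : P.-integrable setT S.
  apply/integrableP; split => //.
  by under eq_integral do rewrite gee0_abs//.
apply: filterS => w /(_ I) Sw.
apply: cvg_series_cvg_0; apply: nondecreasing_is_cvgn.
  by apply: nondecreasing_series => n _ _; exact: Y0.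
exists (fine (S w)) => _ [n _ <-].
rewrite -lee_fin fineK// /series /= -sumEFin.
by apply: nneseries_lim_ge => k _ _; rewrite lee_fin.
Unshelve. all: by end_near. Qed.

(** Chebyshev along the radii n^-2, which are summable, then monotonicity in
    the radius, since consecutive radii have ratio tending to 1. *)
Lemma ae_cvg_of_variance (A : R -> Omega -> R) (m : R -> R) (c C eta0 : R) :
  0 < eta0 -> 0 <= C ->
  (forall x, 0 < x -> measurable_fun setT (A x)) ->
  (forall x, 0 < x -> x < eta0 ->
     (\int[P]_w ((A x w - m x) ^+ 2)%:E <= (C * x ^+ 2)%:E)%E) ->
  m x / Num.sqrt x @[x --> 0^'+] --> c ->
  (forall x w, 0 <= A x w) ->
  {ae P, forall w, forall x y, 0 < x -> x <= y -> y < eta0 -> A x w <= A y w} ->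
  {ae P, forall w, A x w / Num.sqrt x @[x --> 0^'+] --> c}.
Proof.
move=> eta00 C0 mA var mc A0 amono.
pose Y n w := if h n < eta0 then ((A (h n) w - m (h n)) * n.+1%:R) ^+ 2 else 0.
have sumY : {ae P, forall w, Y n w @[n --> \oo] --> (0 : R)}.
  apply: (@ae_cvg0_of_summable _ C) => //.
  - move=> n; rewrite /Y; case: (h n < eta0); last exact: measurable_cst.
    apply: measurable_funX; apply: measurable_funM => //.
    by apply: measurable_funB => //; apply: mA; exact: inv_square_gt0.
  - by move=> n w; rewrite /Y; case: ifP => // _; exact: sqr_ge0.
  - move=> n; rewrite /Y; case hn: (h n < eta0); last first.
      rewrite integral0_eq// lee_fin mulr_ge0//.
      exact/ltW/inv_square_gt0.
    under eq_integral do rewrite exprMn mulrC EFinM.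
    rewrite ge0_integralZl//.
    + apply: (@le_trans _ _ ((n.+1%:R ^+ 2)%:E * (C * h n ^+ 2)%:E)%E).
        by rewrite lee_wpmul2l ?lee_fin ?exprn_ge0// var// inv_square_gt0.
      rewrite -EFinM lee_fin /inv_square le_eqVlt; apply/orP; left; apply/eqP.
      have : n.+1%:R != 0 :> R by [].
      by move: (n.+1%:R : R) => k k0; field.
    + apply/measurable_EFinP; apply: measurable_funX; apply: measurable_funB => //.
      by apply: mA; exact: inv_square_gt0.
    + by move=> w _; rewrite lee_fin sqr_ge0.
apply: filterS2 sumY amono => w Yw mono.
apply: (@interpolate_inv_square _ (A ^~ w) c eta0) => //.
have h0 n : 0 < h n := inv_square_gt0 R n.
have mh : m (h n) * n.+1%:R @[n --> \oo] --> c.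
  have := (cvg_at_rightP _ _ _).1 mc h (conj h0 (@inv_square_cvg R)).
  by under eq_cvg do rewrite sqrt_inv_square invrK.
have dh : (A (h n) w - m (h n)) * n.+1%:R @[n --> \oo] --> (0 : R).
  apply/norm_cvg0P.
  have : Num.sqrt (Y n w) @[n --> \oo] --> Num.sqrt (0 : R).
    by apply: (cvg_comp _ _ Yw); exact: sqrt_continuous.
  rewrite sqrtr0; apply: cvg_trans; apply: near_eq_cvg.
  have : \forall n \near \oo, h n < eta0.
    by apply: (cvgr_lt 0) => //; exact: inv_square_cvg.
  by apply: filterS => n hn; rewrite /Y hn sqrtr_sqr.
have -> : (fun n => A (h n) w * n.+1%:R) =
  (fun n => (A (h n) w - m (h n)) * n.+1%:R + m (h n) * n.+1%:R).
  by apply/funext => n; ring.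
by rewrite -[X in _ --> X](add0r c); exact: cvgD.
Qed.

End almost_sure.

(** * The area of the tube as a random variable *)

Section integral_ae.
Import HBNNSimple.

(** The integral of a nonnegative function that is only almost everywhere equal
    to a measurable one: simple functions below it may be cut off on a
    measurable null set, and only there can it exceed the measurable one. *)
Lemma ge0_integral_ae_measurable d (T : measurableType d) (R : realType)
    (mu : {measure set T -> \bar R}) (f g : T -> \bar R) :
  measurable_fun setT g -> (forall x, 0 <= g x)%E -> (forall x, 0 <= f x)%E ->
  {ae mu, forall x, f x = g x} -> (\int[mu]_x f x = \int[mu]_x g x)%E.
Proof.
move=> mg g0 f0 [N [mN N0 fgN]].
have fg x : ~ N x -> f x = g x.
  by move=> Nx; apply: contrapT => fgx; apply: Nx; exact: fgN.
have mNC : measurable (~` N) by exact: measurableC.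
have cut (h : T -> \bar R) : measurable_fun setT h -> (forall x, 0 <= h x)%E ->
    (\int[mu]_x h x = \int[mu]_x (h \_ (~` N)) x)%E.
  move=> mh h0; apply: ae_eq_integral => //.
    by apply/(measurable_restrictT _ _).1 => //; exact: measurable_funTS.
  exists N; split => // x /= Hx; apply: contrapT => Nx; apply: Hx => _.
  by rewrite patchE mem_set.
have mcut (h : T -> \bar R) : measurable_fun setT h ->
    measurable_fun setT (h \_ (~` N)).
  move=> mh; apply/(measurable_restrictT _ _).1 => //; exact: measurable_funTS.
apply/eqP; rewrite eq_le; apply/andP; split.
  rewrite ge0_integralTE//; apply: ge_ereal_sup => _ [h hf <-].
  rewrite -integralT_nnsfun (cut (EFin \o h)); last 2 first.
  - exact/measurable_EFinP.
  - by move=> x; rewrite /= lee_fin.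
  apply: ge0_le_integral => //.
  - by move=> x _; rewrite patchE; case: ifP => // _; rewrite /= lee_fin.
  - by apply: mcut; exact/measurable_EFinP.
  - move=> x _; rewrite patchE; case: ifPn => // /set_mem Nx.
    by rewrite -(fg x Nx); exact: hf.
rewrite (cut g)// !ge0_integralTE//; last first.
  by move=> x; rewrite patchE; case: ifP.
apply: ereal_sup_le => _ [h hg <-];
exists h => // x; apply: le_trans (hg x) _.
by rewrite patchE; case: ifPn => [/set_mem Nx|_]; rewrite ?(fg x Nx).
Qed.

End integral_ae.

Section tube_area.
Context d (Omega : measurableType d) (R : realType) (P : probability Omega R).
Context (B : R -> {RV P >-> R}) (hB : standard_brownian_motion B).
Context (T1 T2 : R) (hT1 : 0 <= T1) (T12 : T1 < T2).
(* the range of times over which the tube is observed, as a function of its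
   radius; m eta is the expected area *)
Context (W : R -> set R) (m : R -> R).
Hypothesis mW : forall eta, measurable (W eta).
Hypothesis subW : forall eta, 0 < eta -> W eta `<=` `[T1 - eta, T2 + eta].
Hypothesis monoW : forall eta eta', eta <= eta' -> W eta `<=` W eta'.
Hypothesis meanW : forall eta, 0 < eta -> eta < (T2 - T1) / 2 ->
  (\int[@lebesgue_measure R]_(u in W eta) (mean_slice T1 T2 eta u)%:E =
   (m eta)%:E)%E.
Local Notation path w := (fun t => B t w).
Context (S : R -> Omega -> set (R * R)).
Hypothesis SE : {ae P, forall w, forall eta, 0 < eta ->
  S eta w = tube_on T1 T2 (path w) (W eta) eta}.

Definition area_rv_fun eta (w : Omega) : R :=
  fine (swept_area B T1 T2 (W eta) eta w).

Local Lemma measurable_area_rv_fun eta : measurable_fun setT (area_rv_fun eta).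
Proof.
by apply: measurableT_comp => //; exact: measurable_swept_area.
Qed.

Definition area_rv eta : {RV P >-> R} :=
  mfun_Sub (mem_set (measurable_area_rv_fun eta)).

Local Lemma window_fin eta : 0 < eta ->
  (@lebesgue_measure R (W eta) <= (T2 - T1 + 2 * eta)%:E)%E.
Proof.
move=> e0.
apply: (@le_trans _ _ (@lebesgue_measure R `[T1 - eta, (T2 + eta)%R]%classic)).
  by apply: le_measure; [rewrite inE; exact: mW|rewrite inE|exact: subW].
have := T12 => T12'.
rewrite lebesgue_measure_itv/= lte_fin ifT; last by lra.
by rewrite -EFinB lee_fin; lra.
Qed.

Lemma ae_area_rv : {ae P, forall w, forall eta, 0 < eta ->
  measurable (S eta w) /\ lebesgue_measure2 (S eta w) = (area_rv eta w)%:E}.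
Proof.
apply: filterS2 SE (brownian_path_continuous hB) => w Sw cw eta e0.
have cw' : {within `[T1, T2], continuous (path w)} by exact: cw.
rewrite Sw//; split; first exact: measurable_tube_on.
rewrite lebesgue_measure2_tube_on// /area_rv /= /area_rv_fun fineK//.
apply: swept_area_fin_num => //; first exact: subW.
by apply: le_lt_trans (window_fin e0) _; exact: ltry.
Qed.

Local Lemma area_rv_ge0 eta w : 0 <= area_rv eta w.
Proof. by apply: fine_ge0; exact: swept_area_ge0. Qed.

Local Lemma ae_swept_area eta : 0 < eta ->
  {ae P, forall w, swept_area B T1 T2 (W eta) eta w = (area_rv eta w)%:E}.
Proof.
move=> e0; apply: filterS (brownian_path_continuous hB) => w cw.
have cw' : {within `[T1, T2], continuous (path w)} by exact: cw.
rewrite /area_rv /= /area_rv_fun fineK//.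
apply: swept_area_fin_num => //; first exact: subW.
by apply: le_lt_trans (window_fin e0) _; exact: ltry.
Qed.

Lemma expectation_area_rv eta : 0 < eta -> eta < (T2 - T1) / 2 ->
  (\int[P]_w (area_rv eta w)%:E = (m eta)%:E)%E.
Proof.
move=> e0 eT; rewrite -meanW// -(expectation_swept_area hB)//; last exact: subW.
apply: ae_eq_integral => //.
- by apply/measurable_EFinP; exact: measurable_funPT.
- exact: measurable_swept_area.
- by apply: filterS (ae_swept_area e0) => w ->.
Qed.

(** The area is only almost surely equal to a measurable function, so this is not a
    mere rewriting of the expectation of [area_rv]. *)
Lemma expectation_area eta : 0 < eta -> eta < (T2 - T1) / 2 ->
  ('E_P[fun w => area (S eta w)] = (m eta)%:E)%E.
Proof.
move=> e0 eT; rewrite -(expectation_area_rv e0 eT).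
transitivity (\int[P]_w (area (S eta w))%:E)%E.
  by rewrite expectation.unlock.
apply: ge0_integral_ae_measurable.
- by apply/measurable_EFinP; exact: measurable_funPT.
- by move=> w; rewrite lee_fin; exact: area_rv_ge0.
- by move=> w; rewrite lee_fin /area fine_ge0//; exact: measure_ge0.
- apply: filterS ae_area_rv => w /(_ _ e0)[_ h].
  by rewrite /area h.
Qed.

(** The variance is of order eta^2 while the square of the mean is of order eta;
    832 = 8 * (96 + 8). *)
Lemma variance_area_rv eta : 0 < eta -> eta < (T2 - T1) / 2 -> eta <= 1 ->
  (\int[P]_w ((area_rv eta w - m eta) ^+ 2)%:E <=
   (832 * (T2 - T1 + 2) * eta ^+ 2)%:E)%E.
Proof.
move=> e0 eT e1; set A := area_rv eta; set M := m eta.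
have EA : (\int[P]_w (A w)%:E = M%:E)%E by exact: expectation_area_rv.
have mA : measurable_fun setT A by exact: measurable_funPT.
have M0 : 0 <= M.
  by rewrite -lee_fin -EA; apply: integral_ge0 => w _; rewrite lee_fin area_rv_ge0.
have sqA : (\int[P]_w (A w ^+ 2)%:E <=
    (M ^+ 2 + 832 * (T2 - T1 + 2) * eta ^+ 2)%:E)%E.
  have -> : (\int[P]_w (A w ^+ 2)%:E = \int[P]_w
      (swept_area B T1 T2 (W eta) eta w * swept_area B T1 T2 (W eta) eta w))%E.
    apply: ae_eq_integral => //.
    - by apply/measurable_EFinP; exact: measurable_funX.
    - by apply: emeasurable_funM; exact: measurable_swept_area.
    - by apply: filterS (ae_swept_area e0) => w -> _; rewrite expr2 EFinM.
  apply: (le_trans (second_moment_swept_area hB hT1 T12 (mW eta) e0 (subW e0))).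
  rewrite (expectation_swept_area hB hT1 T12 (mW eta) e0 (subW e0)) meanW//.
  rewrite -EFinM EFinD [M ^+ 2]expr2; apply: leeD => //.
  apply: (@le_trans _ _ ((8 * eta * (96 * eta + 8 * eta ^+ 2))%:E *
      (T2 - T1 + 2 * eta)%:E)%E).
    apply: lee_wpmul2l; last exact: window_fin.
    by rewrite lee_fin !mulr_ge0 ?addr_ge0 ?mulr_ge0 ?sqr_ge0// ltW.
  rewrite -EFinM lee_fin.
  have -> : 8 * eta * (96 * eta + 8 * eta ^+ 2) =
    (768 + 64 * eta) * eta ^+ 2 by ring.
  have := T12 => T12'.
  rewrite mulrAC ler_wpM2r ?sqr_ge0//.
  by apply: ler_pM; lra.
have mE (f : Omega -> R) : measurable_fun setT f ->
  measurable_fun setT (fun w => (f w)%:E) by move=> ?; exact/measurable_EFinP.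
have mB : measurable_fun setT (fun w => (A w - M) ^+ 2).
  by apply: measurable_funX; exact: measurable_funB.
(* expansion of the square with nonnegative integrands only *)
have key : (\int[P]_w ((A w - M) ^+ 2)%:E + (2 * M ^+ 2)%:E =
    \int[P]_w (A w ^+ 2)%:E + (M ^+ 2)%:E)%E.
  have -> : (2 * M ^+ 2)%:E = (\int[P]_w ((2 * M)%:E * (A w)%:E))%E.
    rewrite ge0_integralZl//; first by rewrite EA -EFinM; congr EFin; ring.
    - exact: mE.
    - by move=> w _; rewrite lee_fin area_rv_ge0.
    - by rewrite lee_fin mulr_ge0.
  have -> : (M ^+ 2)%:E = (\int[P]_w (M ^+ 2)%:E)%E.
    by rewrite integral_cst//= probability_setT mule1.
  rewrite -!ge0_integralD//.
  - by apply: eq_integral => w _; rewrite -EFinM -!EFinD; congr EFin; ring.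
  - by move=> w _; rewrite lee_fin sqr_ge0.
  - by apply: mE; exact: measurable_funX.
  - by move=> w _; rewrite lee_fin sqr_ge0.
  - by move=> w _; rewrite lee_fin sqr_ge0.
  - exact: mE.
  - by move=> w _; rewrite mule_ge0 ?lee_fin ?mulr_ge0// area_rv_ge0.
  - by apply: emeasurable_funM => //; exact: mE.
rewrite -(@leeD2rE _ (2 * M ^+ 2)%:E)// key.
rewrite -EFinD.
have -> : 832 * (T2 - T1 + 2) * eta ^+ 2 + 2 * M ^+ 2 =
  (M ^+ 2 + 832 * (T2 - T1 + 2) * eta ^+ 2) + M ^+ 2 by ring.
by rewrite [leRHS]EFinD leeD2r.
Qed.

Lemma ae_area_rv_mono :
  {ae P, forall w, forall eta eta', 0 < eta -> eta <= eta' ->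
    area_rv eta w <= area_rv eta' w}.
Proof.
apply: filterS2 SE ae_area_rv => w Sw h eta eta' e0 ee'.
have e'0 : 0 < eta' by exact: lt_le_trans ee'.
have [m1 h1] := h eta e0; have [m2 h2] := h eta' e'0.
rewrite -lee_fin -h1 -h2; apply: le_measure; rewrite ?inE// !Sw//.
move=> s [s1 s2]; split; last exact: monoW s2.
exact: le_trans ee'.
Qed.

Lemma ae_area_asymptotics (c : R) :
  m eta / Num.sqrt eta @[eta --> 0^'+] --> c * (T2 - T1) ->
  {ae P, forall w, exists2 e : R -> R, e eta @[eta --> 0^'+] --> (0 : R) &
    \forall eta \near 0^'+,
      area (S eta w) = (c + e eta) * (T2 - T1) * Num.sqrt eta}.
Proof.
move=> mc.
have T0 : 0 < T2 - T1 by rewrite subr_gt0.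
pose eta0 := Num.min 1 ((T2 - T1) / 2).
have eta00 : 0 < eta0 by rewrite lt_min ltr01 divr_gt0.
have := @ae_cvg_of_variance _ _ _ P area_rv m (c * (T2 - T1))
  (832 * (T2 - T1 + 2)) eta0 eta00.
have C0 : 0 <= 832 * (T2 - T1 + 2) by have := T12; lra.
move=> /(_ C0 _ _ mc (fun x w => area_rv_ge0 x w) _) Acvg.
have {}Acvg : {ae P, forall w,
    area_rv x w / Num.sqrt x @[x --> 0^'+] --> c * (T2 - T1)}.
  apply: Acvg.
  - by move=> x _; exact: measurable_funPT.
  - move=> x x0; rewrite lt_min => /andP[x1 xT].
    by apply: variance_area_rv => //; exact: ltW.
  - by apply: filterS ae_area_rv_mono => w h x y x0 xy _; exact: h.
apply: filterS2 Acvg ae_area_rv => w Aw Sw.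
exists (fun x => area_rv x w / Num.sqrt x / (T2 - T1) - c).
  rewrite [X in _ --> X](_ : _ = c * (T2 - T1) / (T2 - T1) - c); last first.
    by rewrite mulfK ?subrr// gt_eqF.
  apply: cvgB; last exact: cvg_cst.
  by apply: cvgM; [exact: Aw|exact: cvg_cst].
near=> eta.
have e0 : 0 < eta by near: eta; exact: nbhs_right_gt.
have [_ h] := Sw eta e0; rewrite /area h /=.
have T0' : T2 - T1 != 0 by rewrite gt_eqF.
have s0 : Num.sqrt eta != 0 by rewrite gt_eqF// sqrtr_gt0.
by rewrite addrC subrK divfK// divfK.
Unshelve. all: by end_near. Qed.

End tube_area.

(** * Proof of the theorem *)

Section mean_asymptotics.
Context (R : realType) (T1 T2 : R).

Local Lemma sqrt_cvg0 : Num.sqrt x @[x --> 0^'+] --> (0 : R).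
Proof.
rewrite -[X in _ --> X]sqrtr0; apply: cvg_at_right_filter.
exact: sqrt_continuous.
Qed.

Local Lemma id_cvg0 : x @[x --> (0 : R)^'+] --> (0 : R).
Proof. by apply: cvg_at_right_filter; exact: cvg_id. Qed.

Lemma mean_area_asymptotics :
  mean_area T1 T2 x / Num.sqrt x @[x --> 0^'+] -->
    4 / Num.sqrt pi * (T2 - T1).
Proof.
pose k : R := 8 * (Num.sqrt 2 - 1) / (3 * Num.sqrt pi).
have h : 4 / Num.sqrt pi * (T2 - T1) + 2 * (T2 - T1) * Num.sqrt x - k * x
    @[x --> 0^'+] --> 4 / Num.sqrt pi * (T2 - T1) + 2 * (T2 - T1) * 0 - k * 0.
  apply: cvgB; last by apply: cvgM; [exact: cvg_cst|exact: id_cvg0].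
  apply: cvgD; first exact: cvg_cst.
  by apply: cvgM; [exact: cvg_cst|exact: sqrt_cvg0].
rewrite !mulr0 addr0 subr0 in h; apply: cvg_trans h.
apply: near_eq_cvg; near=> x.
have x0 : 0 < x by near: x; exact: nbhs_right_gt.
have s0 : Num.sqrt x != 0 by rewrite gt_eqF// sqrtr_gt0.
rewrite /mean_area powR32// -/k.
have xE : x = Num.sqrt x * Num.sqrt x by rewrite -expr2 sqr_sqrtr// ltW.
move: s0 xE; move: (Num.sqrt x) => s s0 ->; field.
by rewrite s0 gt_eqF// sqrtr_gt0 pi_gt0.
Unshelve. all: by end_near. Qed.

Lemma mean_area_caps_asymptotics :
  mean_area_caps x / Num.sqrt x @[x --> (0 : R)^'+] --> (0 : R).
Proof.
pose k : R := 8 * Num.sqrt 2 / (3 * Num.sqrt pi).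
have h : k * x + 4 * (x * Num.sqrt x) @[x --> 0^'+] --> k * 0 + 4 * (0 * 0).
  apply: cvgD; first by apply: cvgM; [exact: cvg_cst|exact: id_cvg0].
  apply: cvgM; first exact: cvg_cst.
  by apply: cvgM; [exact: id_cvg0|exact: sqrt_cvg0].
rewrite !mulr0 addr0 in h; apply: cvg_trans h.
apply: near_eq_cvg; near=> x.
have x0 : 0 < x by near: x; exact: nbhs_right_gt.
have s0 : Num.sqrt x != 0 by rewrite gt_eqF// sqrtr_gt0.
rewrite /mean_area_caps powR32// -/k.
have xE : x = Num.sqrt x * Num.sqrt x by rewrite -expr2 sqr_sqrtr// ltW.
move: s0 xE; move: (Num.sqrt x) => s s0 ->; field.
exact: s0.
Unshelve. all: by end_near. Qed.

End mean_asymptotics.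

Theorem mainTheorem4 (d : measure_display) (Omega : measurableType d)
    (R : realType) (P : probability Omega R) (B : R -> {RV P >-> R})
    (hB : standard_brownian_motion B)
    (T1 T2 : R) (hT1 : 0 <= T1) (hT12 : T1 < T2) :
  let full (eta : R) (w : Omega) := tube (fun t => B t w) T1 T2 eta in
  let between (eta : R) (w : Omega) :=
    tube_between (fun t => B t w) T1 T2 eta in
  let asymptotic (S : R -> Omega -> set (R * R)) (w : Omega) : Prop :=
    exists2 e : R -> R, e eta @[eta --> 0^'+] --> (0 : R) &
      \forall eta \near 0^'+,
        area (S eta w) = (4 / Num.sqrt pi + e eta) * (T2 - T1) * Num.sqrt eta in
  [/\ area_well_defined P full /\ area_well_defined P between,
      (forall eta : R, 0 < eta -> eta < (T2 - T1) / 2 ->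
        let formula : R :=
          4 / Num.sqrt pi * (T2 - T1) * Num.sqrt eta
          + 2 * (T2 - T1) * eta
          - 8 * (Num.sqrt 2 - 1) / (3 * Num.sqrt pi) * eta `^ (3 / 2) in
        ('E_P[fun w => area (between eta w)] = formula%:E)%E /\
        ('E_P[fun w => area (full eta w)] =
          (formula + 8 * Num.sqrt 2 / (3 * Num.sqrt pi) * eta `^ (3 / 2)
           + 4 * eta ^+ 2)%:E)%E)
    & {ae P, forall w, asymptotic full w} /\
      {ae P, forall w, asymptotic between w}].
Proof.
move=> full between asymptotic.
pose Wf (eta : R) : set R := `[T1 - eta, T2 + eta]%classic.
pose Wb (eta : R) : set R := `[T1, T2]%classic.
have mWf eta : measurable (Wf eta).
  by rewrite /Wf; exact: measurable_itv.
have mWb eta : measurable (Wb eta).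
  by rewrite /Wb; exact: measurable_itv.
have subf eta : 0 < eta -> Wf eta `<=` `[T1 - eta, T2 + eta].
  by move=> _ x.
have subb eta : 0 < eta -> Wb eta `<=` `[T1 - eta, T2 + eta].
  by move=> e0; apply: subset_itvScc; rewrite bnd_simp; lra.
have monof eta eta' : eta <= eta' -> Wf eta `<=` Wf eta'.
  by move=> ee; apply: subset_itvScc; rewrite bnd_simp; lra.
have monob eta eta' : eta <= eta' -> Wb eta `<=` Wb eta'.
  by move=> _ x.
pose mf eta := mean_area T1 T2 eta + mean_area_caps eta.
have meanf := @integral_mean_full R T1 T2.
have meanb := @integral_mean_between R T1 T2.
have Sf : {ae P, forall w, forall eta, 0 < eta ->
    full eta w = tube_on T1 T2 (fun t => B t w) (Wf eta) eta}.
  apply: filterS (brownian_path_continuous hB) => w cw eta e0.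
  rewrite /full /tube_on setIidl// => -[u v] /= uv.
  rewrite /Wf /= in_itv/=; apply: contrapT => /negP uI.
  have := @tube_slice_empty _ _ _ _ (ltW hT12) (cw T1 T2 hT1) u eta uI.
  by move=> /seteqP[/(_ v)/= + _]; apply.
have Sb : {ae P, forall w, forall eta, 0 < eta ->
    between eta w = tube_on T1 T2 (fun t => B t w) (Wb eta) eta}.
  apply: filterS (brownian_path_continuous hB) => w cw eta e0.
  by rewrite /between /tube_between /tube_on; congr (_ `&` _).
split.
- split.
    by exists (area_rv B T1 T2 mWf); exact: (ae_area_rv hB).
  by exists (area_rv B T1 T2 mWb); exact: (ae_area_rv hB).
- move=> eta e0 eT formula; split.
    exact: (expectation_area hB hT1 hT12 mWb subb meanb Sb e0 eT).
  have := expectation_area hB hT1 hT12 mWf subf meanf Sf e0 eT.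
  by rewrite /mean_area /mean_area_caps addrA.
- split.
    apply: (ae_area_asymptotics hB hT1 hT12 mWf subf monof meanf Sf).
    rewrite -[X in _ --> X]addr0.
    rewrite (_ : (fun _ => _) = (fun x => mean_area T1 T2 x / Num.sqrt x +
      mean_area_caps x / Num.sqrt x)); last by apply/funext => x; rewrite mulrDl.
    apply: cvgD; first exact: mean_area_asymptotics.
    exact: mean_area_caps_asymptotics.
  apply: (ae_area_asymptotics hB hT1 hT12 mWb subb monob meanb Sb).
  exact: mean_area_asymptotics.
Qed.
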